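(* Let $\mathbf{P}$ be the category of Polish groups and continuous group homomorphisms, let $\mathbf{PC}$ be the category of groups with a Polish cover and Borel-definable homomorphisms, and let $\mathcal S$ be a thick subcategory of $\mathbf{P}$. Then the canonical equivalence $\mathrm{Ex}(\mathbf{P})\simeq\mathbf{PC}$ restricts to an equivalence between $\mathrm{Ex}(\mathcal S)$ and the full subcategory of $\mathbf{PC}$ spanned by the $\mathcal S$-groups with a Polish cover.
   Context: A subgroup $N$ of a Polish group $G$ is a Polish subgroup if it carries a (necessarily unique) Polish group topology for which the inclusion $N\to G$ is continuous; it is then always considered with this topology. A group with a Polish cover is a quotient group $G/N$ where $G$ is a Polish group and $N$ is a normal Polish subgroup of $G$ (the pair $(G,N)$ is part of the data). A group homomorphism $f:G/N\to H/M$ is Borel-definable if there is a Borel function $\tilde f:G\to H$ with $f(gN)=\tilde f(g)M$ for all $g\in G$. The coset relation $E_N^G=\{(g,h)\in G\times G: gN=hN\}$ is a Polish subgroup of $G\times G$. A functor between regular categories is regular if it preserves finite limits and regular epimorphisms. A regular subcategory of a regular category $\mathcal C$ is a full subcategory that is itself a regular category and whose inclusion functor into $\mathcal C$ is regular. The category $\mathbf{P}$ is homological (pointed, regular, protomodular); its regular epimorphisms are the surjective continuous homomorphisms, its subobjects are given by Polish subgroups, and a short exact sequence $1\to K\to X\to Y\to 1$ in $\mathbf P$ is given by a surjective continuous homomorphism $X\to Y$ together with its kernel. A thick subcategory $\mathcal S$ of $\mathbf P$ is a regular subcategory such that for every subobject $X$ in $\mathbf P$ of an object of $\mathcal S$ and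 every short exact sequence $1\to K\to X\to Y\to 1$ in $\mathbf P$, $X$ is isomorphic to an object of $\mathcal S$ if and only if both $K$ and $Y$ are isomorphic to objects of $\mathcal S$. An $\mathcal S$-group with a Polish cover is a group with a Polish cover $G/N$ such that both $G$ and $E_N^G$ are in $\mathcal S$ (up to isomorphism of Polish groups). Exact completion (ex/reg completion). Let $\mathcal C$ be a regular category. A relation from $X$ to $Y$ is a subobject $R\hookrightarrow X\times Y$. The composite $SR$ of a relation $R$ from $X$ to $Y$ with a relation $S$ from $Y$ to $Z$ is the regular image of $R\times_Y S\to X\times Z$; $R^\circ$ is the opposite relation, $\leq$ the inclusion of subobjects. The objects of $\mathrm{Ex}(\mathcal C)$ are pairs $(X,R)$ with $R$ an internal equivalence relation on the object $X$ of $\mathcal C$. A morphism $(X,R)\to (Y,S)$ is a relation $T$ from $X$ to $Y$ such that $TR=T=ST$, $R\leq T^\circ T$, and $TT^\circ\leq S$. Composition is composition of relations, and the identity of $(X,R)$ is $R$. The inclusion $\mathcal S\to\mathbf P$ induces a canonical functor $\mathrm{Ex}(\mathcal S)\to\mathrm{Ex}(\mathbf P)$, $(X,R)\mapsto (X,R)$, $T\mapsto T$. The canonical equivalence $\mathrm{Ex}(\mathbf P)\simeq\mathbf{PC}$ sends an internal equivalence relation on $G$, which is necessarily of the form $E_N^G$ for a normal Polish subgroup $N$ of $G$, to $G/N$, and sends a morphism $T:(G,E_N^G)\to(H,E_M^H)$ to the homomorphism $f_T:G/N\to H/M$ with $f_T(gN)=hM$ whenever $(g,h)\in T$. That it ''restricts''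 means that its composite with $\mathrm{Ex}(\mathcal S)\to\mathrm{Ex}(\mathbf P)$ is an equivalence onto the indicated subcategory. *)

(* Defs.v *)
From HB Require Import structures.
From mathcomp Require Import all_boot all_order all_algebra.
From mathcomp Require Import all_classical all_reals topology measurable_structure.

Set Implicit Arguments.
Unset Strict Implicit.
Unset Printing Implicit Defensive.

Local Open Scope classical_set_scope.

Record category := Category {
  obj :> Type;
  hom : obj -> obj -> Type;
  idm : forall x, hom x x;
  comp : forall x y z, hom y z -> hom x y -> hom x z;
  comp1m : forall x y (f : hom x y), comp (idm y) f = f;
  compm1 : forall x y (f : hom x y), comp f (idm x) = f;
  compmA : forall w x y z (h : hom y z) (g : hom x y) (f : hom w x),
    comp h (comp g f) = comp (comp h g) f }.

Arguments hom {c}.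
Arguments idm {c}.
Arguments comp {c x y z}.
Notation "g \c f" := (comp g f) (at level 40, left associativity).

Definition is_iso (C : category) (x y : C) (f : hom x y) :=
  exists g : hom y x, g \c f = idm x /\ f \c g = idm y.

Definition isomorphic (C : category) (x y : C) := exists f : hom x y, is_iso f.

Definition mono (C : category) (x y : C) (f : hom x y) :=
  forall w (g h : hom w x), f \c g = f \c h -> g = h.

Record functor (C D : category) := Functor {
  fobj :> C -> D;
  fmap : forall x y, hom x y -> hom (fobj x) (fobj y);
  fmap1 : forall x, fmap (idm x) = idm (fobj x);
  fmapM : forall x y z (g : hom y z) (f : hom x y),
    fmap (g \c f) = fmap g \c fmap f }.

Arguments fmap {C D} _ {x y} _.

Definition functor_id (C : category) : functor C C.
Proof. by exists (fun x => x) (fun _ _ f => f). Defined.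

Definition functor_comp (C D E : category) (G : functor D E) (F : functor C D) :
  functor C E.
Proof.
exists (fun x => G (F x)) (fun _ _ f => fmap G (fmap F f)).
- by move=> x; rewrite !fmap1.
- by move=> x y z g f; rewrite !fmapM.
Defined.

Definition naturally_isomorphic (C D : category) (F G : functor C D) :=
  exists2 eta : forall x, hom (F x) (G x), (forall x, is_iso (eta x)) &
    forall x y (f : hom x y), fmap G f \c eta x = eta y \c fmap F f.

Definition is_equivalence (C D : category) (F : functor C D) :=
  exists G : functor D C,
    naturally_isomorphic (functor_comp G F) (functor_id C) /\
    naturally_isomorphic (functor_comp F G) (functor_id D).

Section FullSubcategory.
Variables (C : category) (P : C -> Prop).

Definition full_subcategory : category.
Proof.
exists {x : C | P x} (fun x y => hom (sval x) (sval y)) (fun x => idm (sval x))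
  (fun _ _ _ g f => g \c f).
- by move=> x y f; exact: comp1m.
- by move=> x y f; exact: compm1.
- by move=> w x y z h g f; exact: compmA.
Defined.

Definition inclusion : functor full_subcategory C.
Proof. by exists (fun x => sval x) (fun _ _ f => f). Defined.

Definition corestriction (B : category) (F : functor B C)
  (PF : forall x, P (F x)) : functor B full_subcategory.
Proof.
exists (fun x => exist P (F x) (PF x) : full_subcategory) (fun _ _ f => fmap F f).
- by move=> x; exact: fmap1.
- by move=> x y z g f; exact: fmapM.
Defined.

End FullSubcategory.

Arguments corestriction {C} P {B} F PF.

Section Limits.
Variable C : category.

Definition is_cone (J : category) (D : functor J C) (L : C)
    (p : forall j, hom L (D j)) :=
  forall i j (u : hom i j), fmap D u \c p i = p j.

Definition is_limit (J : category) (D : functor J C) (L : C)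
    (p : forall j, hom L (D j)) :=
  is_cone p /\ forall (M : C) (q : forall j, hom M (D j)), is_cone q ->
    exists! h : hom M L, forall j, p j \c h = q j.

Definition is_pullback (x y z w : C) (f : hom x z) (g : hom y z)
    (p : hom w x) (q : hom w y) :=
  f \c p = g \c q /\ forall (v : C) (a : hom v x) (b : hom v y),
    f \c a = g \c b -> exists! h : hom v w, p \c h = a /\ q \c h = b.

Definition is_product (x y w : C) (p : hom w x) (q : hom w y) :=
  forall (v : C) (a : hom v x) (b : hom v y),
    exists! h : hom v w, p \c h = a /\ q \c h = b.

Definition is_coequalizer (x y z : C) (u v : hom x y) (e : hom y z) :=
  e \c u = e \c v /\ forall (w : C) (h : hom y w),
    h \c u = h \c v -> exists! k : hom z w, k \c e = h.

Definition regular_epi (y z : C) (e : hom y z) :=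
  exists (x : C) (u v : hom x y), is_coequalizer u v e.

End Limits.

(* [finite_set] is avoided here: it is defined through [set_type], whose
   universe would then have to contain the large categories below. *)
Definition finite_type (T : Type) :=
  exists (n : nat) (f : 'I_n -> T), forall x, exists i, f i = x.

Definition finite_category (J : category) :=
  finite_type J /\ forall i j : J, finite_type (hom i j).

Definition has_finite_limits (C : category) :=
  forall J : category, finite_category J -> forall D : functor J C,
    exists (L : C) (p : forall j, hom L (D j)), is_limit p.

Definition regular_category (C : category) :=
  [/\ has_finite_limits C,
      (forall (x y k : C) (f : hom x y) (u v : hom k x), is_pullback f f u v ->
        exists (z : C) (e : hom x z), is_coequalizer u v e) &
      (forall (x y z w : C) (f : hom x z) (g : hom y z)
        (p : hom w x) (q : hom w y),
        is_pullback f g p q -> regular_epi f -> regular_epi q)].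

Definition preserves_finite_limits (C D : category) (F : functor C D) :=
  forall J : category, finite_category J ->
  forall (K : functor J C) (L : C) (p : forall j, hom L (K j)),
    is_limit p -> @is_limit D J (functor_comp F K) (F L) (fun j => fmap F (p j)).

Definition regular_functor (C D : category) (F : functor C D) :=
  preserves_finite_limits F /\
  forall (x y : C) (e : hom x y), regular_epi e -> regular_epi (fmap F e).

Section ThinCategory.
Variables (I : finType) (r : rel I) (r_refl : reflexive r) (r_trans : transitive r).

Definition thin : category.
Proof.
exists I (fun i j => r i j) (fun i => r_refl i)
  (fun i j k v u => r_trans u v).
- by move=> *; exact: bool_irrelevance.
- by move=> *; exact: bool_irrelevance.
- by move=> *; exact: bool_irrelevance.
Defined.

Lemma thin_finite : finite_category thin.
Proof.
split; first by exists #|I|, enum_val => x; exists (enum_rank x); exact: enum_rankK.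
move=> i j; case: (boolP (r i j)) => [rij|/negP nrij].
  by exists 1%N, (fun=> rij) => x; exists ord0; exact: bool_irrelevance.
exists 0%N; have f0 (k : 'I_0) : hom (i : thin) j by case: k.
by exists f0 => x; case: (nrij x).
Qed.

End ThinCategory.

Definition cospan_rel : rel (option bool) := [rel i j | (i == j) || (j == None)].

Lemma cospan_refl : reflexive cospan_rel. Proof. by case=> [[]|]. Qed.
Lemma cospan_trans : transitive cospan_rel.
Proof. by case=> [[]|] [[]|] [[]|]. Qed.

Lemma bool_eq_refl : reflexive (@eq_op bool). Proof. exact: eqxx. Qed.
Lemma bool_eq_trans : transitive (@eq_op bool). Proof. by case=> [] [] []. Qed.

Section Shapes.
Variable C : category.

Section Cospan.
Variables (x y z : C) (f : hom x z) (g : hom y z).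

Definition cospan_obj (i : option bool) : C :=
  match i with Some true => x | Some false => y | None => z end.

Definition cospan_map (i j : option bool) :
    cospan_rel i j -> hom (cospan_obj i) (cospan_obj j) :=
  match i, j return cospan_rel i j -> hom (cospan_obj i) (cospan_obj j) with
  | Some true, Some true => fun=> idm x
  | Some false, Some false => fun=> idm y
  | None, None => fun=> idm z
  | Some true, None => fun=> f
  | Some false, None => fun=> g
  | Some true, Some false | Some false, Some true
  | None, Some true | None, Some false =>
      fun u => match notF u with end
  end.

Definition cospan : functor (thin cospan_refl cospan_trans) C.
Proof.
exists cospan_obj cospan_map.
- by case=> [[]|].
- by move=> [[]|] [[]|] [[]|] //= *; rewrite ?comp1m ?compm1.
Defined.

Definition cospan_cone (w : C) (p : hom w x) (q : hom w y) :
    forall j, hom w (cospan j) :=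
  fun j => match j with Some true => p | Some false => q | None => f \c p end.

Lemma cospan_coneP (w : C) (p : hom w x) (q : hom w y) :
  is_cone (cospan_cone p q) <-> f \c p = g \c q.
Proof.
split=> [H|H]; first by rewrite (H (Some false) None isT).
by move=> [[]|] [[]|] //= _; rewrite ?comp1m.
Qed.

Lemma cospan_cone_eq (w : C) (t : forall j, hom w (cospan j)) : is_cone t ->
  forall j, cospan_cone (t (Some true)) (t (Some false)) j = t j.
Proof. by move=> Ht [[]|] //=; rewrite -(Ht (Some true) None isT). Qed.

Lemma pullback_limit (w : C) (p : hom w x) (q : hom w y) :
  is_pullback f g p q <-> is_limit (cospan_cone p q).
Proof.
split=> -[Hc Hu].
  split=> [|v t Ht]; first exact/cospan_coneP.
  have Htt : f \c t (Some true) = g \c t (Some false).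
    by rewrite (Ht (Some true) None isT) (Ht (Some false) None isT).
  have [h [[h1 h2] hu]] := Hu _ _ _ Htt.
  exists h; split.
    by move=> [[]|] //=; rewrite -compmA h1 (Ht (Some true) None isT).
  by move=> k Hk; apply: hu; split; [rewrite -(Hk (Some true))|rewrite -(Hk (Some false))].
split=> [|v a b ab]; first exact/cospan_coneP.
have /cospan_coneP Ht := ab.
have [h [H hu]] := Hu _ _ Ht.
exists h; split; first by split; [exact: (H (Some true))|exact: (H (Some false))].
move=> k [k1 k2]; apply: hu => -[[]|] //=.
by rewrite -compmA k1.
Qed.

End Cospan.

Section Pair.
Variables (x y : C).

Definition pair_obj (i : bool) : C := if i then x else y.

Definition pair_map (i j : bool) : i == j -> hom (pair_obj i) (pair_obj j) :=
  match i, j return i == j -> hom (pair_obj i) (pair_obj j) with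
  | true, true => fun=> idm x
  | false, false => fun=> idm y
  | true, false | false, true => fun u => match notF u with end
  end.

Definition pair_diagram : functor (thin bool_eq_refl bool_eq_trans) C.
Proof.
exists pair_obj pair_map.
- by case.
- by move=> [] [] [] //= *; rewrite comp1m.
Defined.

Definition pair_cone (w : C) (p : hom w x) (q : hom w y) :
  forall j, hom w (pair_diagram j) := fun j => match j with true => p | false => q end.

Lemma pair_is_cone (w : C) (t : forall j, hom w (pair_diagram j)) : is_cone t.
Proof. by move=> [] [] //= _; rewrite comp1m. Qed.

Lemma product_limit (w : C) (p : hom w x) (q : hom w y) :
  is_product p q <-> is_limit (pair_cone p q).
Proof.
split=> [H|[_ H] v a b].
  split=> [|v t _]; first exact: pair_is_cone.
  have [h [[h1 h2] hu]] := H v (t true) (t false).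
  exists h; split; first by case.
  by move=> k Hk; apply: hu; split; [rewrite -(Hk true)|rewrite -(Hk false)].
have [h [Hh hu]] := H _ _ (pair_is_cone (pair_cone a b)).
exists h; split; first by split; [exact: (Hh true)|exact: (Hh false)].
by move=> k [k1 k2]; apply: hu; case.
Qed.

End Pair.
End Shapes.

Lemma pullback_exists (C : category) : has_finite_limits C ->
  forall (x y z : C) (f : hom x z) (g : hom y z),
  exists (w : C) (p : hom w x) (q : hom w y), is_pullback f g p q.
Proof.
move=> HC x y z f g.
have [w [t [tc tl]]] := HC _ (thin_finite _ _) (cospan f g).
exists w, (t (Some true)), (t (Some false)); apply/pullback_limit.
suff -> : cospan_cone f g (t (Some true)) (t (Some false)) = t by [].
by apply: functional_extensionality_dep => j; exact: cospan_cone_eq.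
Qed.

Lemma product_exists (C : category) : has_finite_limits C ->
  forall x y : C, exists (w : C) (p : hom w x) (q : hom w y), is_product p q.
Proof.
move=> HC x y.
have [w [t tl]] := HC _ (thin_finite _ _) (pair_diagram x y).
exists w, (t true), (t false); apply/product_limit.
suff -> : pair_cone (t true) (t false) = t by [].
by apply: functional_extensionality_dep => -[].
Qed.

Section PreservedShapes.
Variables (C D : category) (F : functor C D).
Hypothesis HF : preserves_finite_limits F.

Lemma preserves_pullback (x y z w : C) (f : hom x z) (g : hom y z)
    (p : hom w x) (q : hom w y) :
  is_pullback f g p q -> is_pullback (fmap F f) (fmap F g) (fmap F p) (fmap F q).
Proof.
move=> pb; have [pbc _] := pb; move: pb.
move=> /pullback_limit /(HF (thin_finite _ _)) [_ H].
split=> [|v a b ab]; first by rewrite -!fmapM pbc.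
pose t (j : option bool) : hom v (functor_comp F (cospan f g) j) :=
  match j with Some true => a | Some false => b | None => fmap F f \c a end.
have tc : @is_cone D _ (functor_comp F (cospan f g)) v t.
  by move=> [[]|] [[]|] //= _; rewrite ?fmap1 ?comp1m.
have [h [h1 hu]] := H _ _ tc; exists h; split.
  by split; [exact: (h1 (Some true))|exact: (h1 (Some false))].
move=> k [k1 k2]; apply: hu => -[[]|] //=.
by rewrite fmapM -compmA k1.
Qed.

Lemma preserves_product (x y w : C) (p : hom w x) (q : hom w y) :
  is_product p q -> is_product (fmap F p) (fmap F q).
Proof.
move=> /product_limit /(HF (thin_finite _ _)) [_ H] v a b.
pose t (j : bool) : hom v (functor_comp F (pair_diagram x y) j) :=
  match j with true => a | false => b end.
have tc : @is_cone D _ (functor_comp F (pair_diagram x y)) v t.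
  by move=> [] [] //= _; rewrite fmap1 comp1m.
have [h [h1 hu]] := H _ _ tc; exists h; split.
  by split; [exact: (h1 true)|exact: (h1 false)].
by move=> k [k1 k2]; apply: hu; case.
Qed.

End PreservedShapes.

Section Spans.
Variable C : category.

Record span (x y : C) := Span {
  apex : C;
  leg1 : hom apex x;
  leg2 : hom apex y }.

Definition jointly_monic (x y : C) (s : span x y) :=
  forall w (f g : hom w (apex s)),
    leg1 s \c f = leg1 s \c g -> leg2 s \c f = leg2 s \c g -> f = g.

Definition span_le (x y : C) (s t : span x y) :=
  exists k : hom (apex s) (apex t), leg1 t \c k = leg1 s /\ leg2 t \c k = leg2 s.

Definition span_equiv (x y : C) (s t : span x y) := span_le s t /\ span_le t s.

(* A subobject of X x Y is an isomorphism class of monomorphisms into X x Y;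
   by [jointly_monicP], these are the jointly monic spans from X to Y. *)
Lemma jointly_monicP (x y w : C) (p : hom w x) (q : hom w y) :
  is_product p q ->
  forall (s : span x y) (m : hom (apex s) w),
    p \c m = leg1 s -> q \c m = leg2 s -> mono m <-> jointly_monic s.
Proof.
move=> H s m m1 m2; split=> [mm v f g|js v f g fg].
  rewrite -m1 -m2 -!compmA => e1 e2; apply: mm.
  have [h [_ hu]] := H v (p \c (m \c g)) (q \c (m \c g)).
  by rewrite -(hu (m \c f)) // (hu (m \c g)).
by apply: js; rewrite -?m1 -?m2 -!compmA fg.
Qed.

Record relation (x y : C) := Relation {
  rspan :> span x y -> Prop;
  rspanP : exists2 s, jointly_monic s &
    rspan = fun t => jointly_monic t /\ span_equiv s t }.

(* [rmem R a b] : the generalized element (a, b) of X x Y belongs to R. *)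
Definition rmem (x y : C) (R : relation x y) (v : C) (a : hom v x) (b : hom v y) :=
  exists2 s, rspan R s &
    exists k : hom v (apex s), leg1 s \c k = a /\ leg2 s \c k = b.

Definition rle (x y : C) (R T : relation x y) :=
  forall s, rspan R s -> exists2 t, rspan T t & span_le s t.

Lemma span_equiv_refl (x y : C) (s : span x y) : span_equiv s s.
Proof. by split; exists (idm _); rewrite !compm1. Qed.

Lemma span_le_trans (x y : C) (s t u : span x y) :
  span_le s t -> span_le t u -> span_le s u.
Proof.
move=> [k [k1 k2]] [l [l1 l2]]; exists (l \c k).
by rewrite !compmA l1 l2.
Qed.

Lemma relation_ext_span (x y : C) (R T : relation x y) :
  (forall s, rspan R s <-> rspan T s) -> R = T.
Proof.
case: R T => [R RP] [T TP] /= RT.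
have {}RT : R = T by apply/funext => s; exact/propext.
by subst T; congr Relation; exact: Prop_irrelevance.
Qed.

Lemma rspan_jm (x y : C) (R : relation x y) s : rspan R s -> jointly_monic s.
Proof. by have [t _ ->] := rspanP R => -[]. Qed.

Lemma rspan_ex (x y : C) (R : relation x y) : exists s, rspan R s.
Proof. by have [t jt ->] := rspanP R; exists t; split=> //; exact: span_equiv_refl. Qed.

Lemma rspan_equiv (x y : C) (R : relation x y) s t :
  rspan R s -> rspan R t <-> jointly_monic t /\ span_equiv s t.
Proof.
have [r jr ->] := rspanP R => -[js [rs sr]]; split=> -[jt [a b]]; split=> //; split.
- exact: span_le_trans sr a.
- exact: span_le_trans b rs.
- exact: span_le_trans rs a.
- exact: span_le_trans b sr.
Qed.

Lemma rmemE (x y : C) (R : relation x y) s : rspan R s ->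
  forall v (a : hom v x) (b : hom v y), rmem R a b <->
    exists k : hom v (apex s), leg1 s \c k = a /\ leg2 s \c k = b.
Proof.
move=> Rs v a b; split=> [[t Rt [k [<- <-]]]|[k kP]]; last by exists s => //; exists k.
have [_ [_ [m [m1 m2]]]] := (rspan_equiv t Rs).1 Rt.
by exists (m \c k); rewrite !compmA m1 m2.
Qed.

Lemma rmem_leg (x y : C) (R : relation x y) s : rspan R s -> rmem R (leg1 s) (leg2 s).
Proof. by move=> Rs; exists s => //; exists (idm _); rewrite !compm1. Qed.

Lemma rmem_comp (x y : C) (R : relation x y) v w (a : hom v x) (b : hom v y)
  (f : hom w v) : rmem R a b -> rmem R (a \c f) (b \c f).
Proof. by move=> [s Rs [k [<- <-]]]; exists s => //; exists (k \c f); rewrite !compmA. Qed.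

Lemma rle_mem (x y : C) (R T : relation x y) :
  rle R T <-> forall v (a : hom v x) (b : hom v y), rmem R a b -> rmem T a b.
Proof.
split=> [RT v a b [s Rs [k [<- <-]]]|RT s Rs].
  have [t Tt [l [l1 l2]]] := RT _ Rs.
  by exists t => //; exists (l \c k); rewrite !compmA l1 l2.
have [t Tt [k kP]] := RT _ _ _ (rmem_leg Rs).
by exists t => //; exists k.
Qed.

Lemma relation_ext (x y : C) (R T : relation x y) :
  (forall v (a : hom v x) (b : hom v y), rmem R a b <-> rmem T a b) -> R = T.
Proof.
move=> RT; have [s Rs] := rspan_ex R; have [t Tt] := rspan_ex T.
have st : span_le s t by apply/(rmemE Tt)/RT/rmem_leg.
have ts : span_le t s by apply/(rmemE Rs)/RT/rmem_leg.
apply: relation_ext_span => u; rewrite (rspan_equiv _ Rs) (rspan_equiv _ Tt).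
split=> -[ju [a b]]; split=> //; split.
- exact: span_le_trans ts a.
- exact: span_le_trans b st.
- exact: span_le_trans st a.
- exact: span_le_trans b ts.
Qed.

Definition relation_of (x y : C) (s : span x y) (js : jointly_monic s) :
  relation x y.
Proof.
by exists (fun t => jointly_monic t /\ span_equiv s t); exists s.
Defined.

Definition span_converse (x y : C) (s : span x y) : span y x :=
  Span (leg2 s) (leg1 s).

Definition converse (x y : C) (R : relation x y) : relation y x.
Proof.
exists (fun s => rspan R (span_converse s)).
have [s Rs] := rspan_ex R; exists (span_converse s).
  by move=> w f g e1 e2; exact: (rspan_jm Rs).
apply/funext => t; apply/propext.
split=> [/(rspan_equiv _ Rs)|[jt] [[k [k1 k2]] [l [l1 l2]]]].
  move=> [jt [[k [k1 k2]] [l [l1 l2]]]]; split; first by move=> w f g ? ?; apply: jt.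
  by split; [exists k|exists l].
apply/(rspan_equiv _ Rs); split; first by move=> w f g ? ?; apply: jt.
by split; [exists k|exists l].
Defined.

Lemma rmem_converse (x y : C) (R : relation x y) v (a : hom v y) (b : hom v x) :
  rmem (converse R) a b <-> rmem R b a.
Proof.
split=> [[s Rs [k [k1 k2]]]|[s Rs [k [k1 k2]]]].
  by exists (span_converse s) => //; exists k.
by exists (span_converse s); [case: s Rs k k1 k2|exists k].
Qed.

(* Internal equivalence relation: for every object V, an equivalence relation
   on the set of morphisms from V to X. *)
Definition is_equivalence_relation (x : C) (R : relation x x) :=
  forall v : C,
    [/\ (forall a : hom v x, rmem R a a),
        (forall a b : hom v x, rmem R a b -> rmem R b a) &
        (forall a b c : hom v x, rmem R a b -> rmem R b c -> rmem R a c)].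

End Spans.

Section RegularRelations.
Variables (C : category) (HC : regular_category C).

Let has_pb (x y z : C) (f : hom x z) (g : hom y z) :
  exists (w : C) (p : hom w x) (q : hom w y), is_pullback f g p q.
Proof. by have [HL _ _] := HC; exact: pullback_exists. Qed.

Lemma regular_epi_epi (x y z : C) (e : hom x y) (f g : hom y z) :
  regular_epi e -> f \c e = g \c e -> f = g.
Proof.
move=> [w [u [v [euv eu]]]] fg.
have fe : f \c e \c u = f \c e \c v by rewrite -!compmA euv.
have [k [_ ku]] := eu _ _ fe.
by rewrite -(ku f) // (ku g).
Qed.

Lemma regular_epi_lift (x y z1 z2 : C) (e : hom x y) (s : span z1 z2)
    (a : hom y z1) (b : hom y z2) (k : hom x (apex s)) :
  regular_epi e -> jointly_monic s ->
  leg1 s \c k = a \c e -> leg2 s \c k = b \c e ->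
  exists d : hom y (apex s), leg1 s \c d = a /\ leg2 s \c d = b.
Proof.
move=> re js k1 k2; have [w [u [v [euv eu]]]] := re.
have kuv : k \c u = k \c v.
  by apply: js; rewrite !compmA ?k1 ?k2 -!compmA euv.
have [d [dk _]] := eu _ _ kuv; exists d.
by split; apply: (regular_epi_epi re); rewrite -compmA dk.
Qed.

Lemma regular_epi_id (x : C) : regular_epi (idm x).
Proof.
exists x, (idm x), (idm x); split=> // w h _; exists h; split.
  by rewrite compm1.
by move=> k; rewrite compm1.
Qed.

Lemma rmem_descent (x y v w : C) (R : relation x y) (e : hom w v)
    (a : hom v x) (b : hom v y) :
  regular_epi e -> rmem R (a \c e) (b \c e) -> rmem R a b.
Proof.
move=> re [s Rs [k [k1 k2]]].
have [d dP] := regular_epi_lift re (rspan_jm Rs) k1 k2.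
by exists s => //; exists d.
Qed.

Lemma image_exists (x y w : C) (a : hom w x) (b : hom w y) :
  exists s : span x y, jointly_monic s /\
    exists e : hom w (apex s), [/\ regular_epi e, leg1 s \c e = a & leg2 s \c e = b].
Proof.
have [HL Hcoeq Hstab] := HC.
have [P [p1 [p2 Pprod]]] := product_exists HL x y.
have [ab [[ab1 ab2] _]] := Pprod _ a b.
have prodI v (f g : hom v P) : p1 \c f = p1 \c g -> p2 \c f = p2 \c g -> f = g.
  move=> e1 e2; have [h [_ hu]] := Pprod v (p1 \c g) (p2 \c g).
  by rewrite -(hu f) // (hu g).
have [K [u [v Kpb]]] := has_pb ab ab.
have [I [e coeq]] := Hcoeq _ _ _ _ _ _ Kpb.
have re : regular_epi e by exists K, u, v.
have [Kc Ku] := Kpb; have [euv eu] := coeq.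
have auv : a \c u = a \c v by rewrite -ab1 -!compmA Kc.
have buv : b \c u = b \c v by rewrite -ab2 -!compmA Kc.
have [p [pe _]] := eu _ _ auv; have [q [qe _]] := eu _ _ buv.
exists (Span p q); split; last by exists e.
move=> /= Z f g pfg qfg.
have [Z1 [f1 [e1 pb1]]] := has_pb e f.
have re1 := Hstab _ _ _ _ _ _ _ _ pb1 re.
have [Z2 [g2 [e2 pb2]]] := has_pb e (g \c e1).
have re2 := Hstab _ _ _ _ _ _ _ _ pb2 re.
have [c1 _] := pb1; have [c2 _] := pb2.
have fg : ab \c (f1 \c e2) = ab \c g2.
  apply: prodI.
    by rewrite !compmA ab1 -pe -!compmA c2 (compmA e f1) c1 !compmA pfg.
  by rewrite !compmA ab2 -qe -!compmA c2 (compmA e f1) c1 !compmA qfg.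
have [h [[h1 h2] _]] := Ku _ _ _ fg.
apply: (regular_epi_epi re1); apply: (regular_epi_epi re2).
by rewrite -c1 -compmA -h1 compmA euv -compmA h2 c2.
Qed.

(* t is the regular image of R x_Y S -> X x Z: the legs of the pullback factor
   through t by the regular epimorphism e. *)
Definition is_composite (x y z : C) (R : relation x y) (S : relation y z)
    (t : span x z) :=
  jointly_monic t /\
  exists (r : span x y) (s : span y z) (w : C) (p : hom w (apex r))
    (q : hom w (apex s)) (e : hom w (apex t)),
  [/\ rspan R r /\ rspan S s, is_pullback (leg2 r) (leg1 s) p q, regular_epi e,
      leg1 t \c e = leg1 r \c p & leg2 t \c e = leg2 s \c q].

Lemma is_composite_mem (x y z : C) (R : relation x y) (S : relation y z)
    (t : span x z) : is_composite R S t ->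
  forall v (a : hom v x) (b : hom v z),
  (exists k : hom v (apex t), leg1 t \c k = a /\ leg2 t \c k = b) <->
  (exists (w : C) (e : hom w v) (c : hom w y),
    [/\ regular_epi e, rmem R (a \c e) c & rmem S c (b \c e)]).
Proof.
have [_ _ Hstab] := HC.
move=> [jt [r [s [w [p [q [e [[Rr Ss] pb re t1 t2]]]]]]]] v a b; split.
  move=> [k [<- <-]].
  have [w' [k' [e' pb']]] := has_pb e k.
  have [c' _] := pb'; have [c _] := pb.
  exists w', e', (leg2 r \c p \c k'); split.
  - exact: Hstab pb' re.
  - rewrite -(compmA (leg1 t)) -c' compmA t1; apply: rmem_comp; apply: rmem_comp.
    exact: rmem_leg.
  - rewrite -(compmA (leg2 t)) -c' compmA t2 c; apply: rmem_comp; apply: rmem_comp.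
    exact: rmem_leg.
move=> [w' [e' [c [re' /(rmemE Rr) [k [k1 k2]] /(rmemE Ss) [l [l1 l2]]]]]].
have [_ pbu] := pb; have [h [[h1 h2] _]] := pbu _ k l (etrans k2 (esym l1)).
apply: (@regular_epi_lift _ _ _ _ e' t a b (e \c h) re' jt).
  by rewrite compmA t1 -compmA h1.
by rewrite compmA t2 -compmA h2.
Qed.

Definition rcomp (x y z : C) (S : relation y z) (R : relation x y) : relation x z.
Proof.
exists (is_composite R S).
have [r Rr] := rspan_ex R; have [s Ss] := rspan_ex S.
have [w [p [q pb]]] := has_pb (leg2 r) (leg1 s).
have [t [jt [e [re t1 t2]]]] := image_exists (leg1 r \c p) (leg2 s \c q).
have ct : is_composite R S t by split=> //; exists r, s, w, p, q, e; split.
exists t => //; apply/funext => u; apply/propext.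
split=> [cu|[ju [[k [k1 k2]] [l [l1 l2]]]]] /=.
  have [ju _] := cu; split=> //.
  split; [apply/(is_composite_mem cu)/(is_composite_mem ct)|
          apply/(is_composite_mem ct)/(is_composite_mem cu)];
  by exists (idm _); rewrite !compm1.
split=> //; exists r, s, w, p, q, (k \c e); split=> //.
- have [c [f [g [efg eu]]]] := re.
  exists c, f, g; split; first by rewrite -!compmA efg.
  move=> v h hfg.
  have lk : l \c k = idm _.
    by apply: jt; rewrite compmA ?l1 ?l2 ?k1 ?k2 compm1.
  have kl : k \c l = idm _.
    by apply: ju; rewrite compmA ?l1 ?l2 ?k1 ?k2 compm1 ?l1 ?l2.
  have [m [me mu]] := eu _ h hfg.
  exists (m \c l); split; first by rewrite -compmA (compmA l) lk comp1m.
  by move=> m' m'e; rewrite (mu (m' \c k)) -?compmA // kl compm1.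
- by rewrite compmA k1.
- by rewrite compmA k2.
Defined.

Lemma rmem_rcomp (x y z : C) (S : relation y z) (R : relation x y)
    v (a : hom v x) (b : hom v z) :
  rmem (rcomp S R) a b <->
  (exists (w : C) (e : hom w v) (c : hom w y),
    [/\ regular_epi e, rmem R (a \c e) c & rmem S c (b \c e)]).
Proof.
have [t ct] := rspan_ex (rcomp S R).
by rewrite (rmemE ct); exact: is_composite_mem.
Qed.

Lemma rmem_rcomp_in (x y z : C) (S : relation y z) (R : relation x y)
    v (a : hom v x) (b : hom v y) (c : hom v z) :
  rmem R a b -> rmem S b c -> rmem (rcomp S R) a c.
Proof.
move=> Rab Sbc; apply/rmem_rcomp; exists v, (idm v), b; rewrite !compm1.
by split=> //; exact: regular_epi_id.
Qed.

Lemma rcompA (w x y z : C) (U : relation y z) (S : relation x y)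
    (R : relation w x) : rcomp U (rcomp S R) = rcomp (rcomp U S) R.
Proof.
apply: relation_ext => v a b; split; move=> /rmem_rcomp [v1 [e1 [c [re1]]]].
  move=> /rmem_rcomp [v2 [e2 [d [re2 Rd Sd]]]] Uc.
  apply: (rmem_descent re1); apply: (rmem_descent re2).
  apply: (rmem_rcomp_in Rd); apply: (rmem_rcomp_in Sd).
  exact: rmem_comp.
move=> Rc /rmem_rcomp [v2 [e2 [d [re2 Rd Sd]]]].
apply: (rmem_descent re1); apply: (rmem_descent re2).
apply: (rmem_rcomp_in _ Sd); apply: (rmem_rcomp_in _ Rd).
exact: rmem_comp.
Qed.

Lemma rcomp_le (x y z : C) (S S' : relation y z) (R R' : relation x y) :
  rle S S' -> rle R R' -> rle (rcomp S R) (rcomp S' R').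
Proof.
move=> /rle_mem SS /rle_mem RR; apply/rle_mem => v a b.
move=> /rmem_rcomp [w [e [c [re /RR Rc /SS Sc]]]].
by apply/rmem_rcomp; exists w, e, c.
Qed.

Lemma converse_rcomp (x y z : C) (S : relation y z) (R : relation x y) :
  converse (rcomp S R) = rcomp (converse R) (converse S).
Proof.
apply: relation_ext => v a b; rewrite rmem_converse !rmem_rcomp.
by split=> -[w [e [c [re A B]]]]; exists w, e, c; split=> //; exact/rmem_converse.
Qed.

End RegularRelations.

Lemma rle_trans (C : category) (x y : C) (R S T : relation x y) :
  rle R S -> rle S T -> rle R T.
Proof. by move=> /rle_mem RS /rle_mem ST; apply/rle_mem => v a b /RS /ST. Qed.

Lemma rle_refl (C : category) (x y : C) (R : relation x y) : rle R R.
Proof. by apply/rle_mem. Qed.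

Section ExactCompletion.
Variables (C : category) (HC : regular_category C).

Record ex_obj := ExObj {
  ex_base : C;
  ex_rel : relation ex_base ex_base;
  ex_relP : is_equivalence_relation ex_rel }.

Record ex_hom (A B : ex_obj) := ExHom {
  ex_graph : relation (ex_base A) (ex_base B);
  ex_homr : rcomp HC ex_graph (ex_rel A) = ex_graph;
  ex_homl : rcomp HC (ex_rel B) ex_graph = ex_graph;
  ex_total : rle (ex_rel A) (rcomp HC (converse ex_graph) ex_graph);
  ex_functional : rle (rcomp HC ex_graph (converse ex_graph)) (ex_rel B) }.

Arguments ex_total {A B} e.
Arguments ex_functional {A B} e.

Lemma ex_hom_ext (A B : ex_obj) (T U : ex_hom A B) :
  ex_graph T = ex_graph U -> T = U.
Proof.
case: T U => [T ? ? ? ?] [U ? ? ? ?] /= TU; subst U.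
by congr ExHom; exact: Prop_irrelevance.
Qed.

Lemma ex_rel_idem (A : ex_obj) : rcomp HC (ex_rel A) (ex_rel A) = ex_rel A.
Proof.
apply: relation_ext => v a b; split.
  move=> /rmem_rcomp [w [e [c [re Rc cR]]]].
  have [_ _ tr] := ex_relP A w.
  by apply: (rmem_descent re); exact: tr Rc cR.
by move=> ab; apply: (rmem_rcomp_in HC _ ab); have [r _ _] := ex_relP A v; exact: r.
Qed.

Lemma ex_rel_converse (A : ex_obj) : converse (ex_rel A) = ex_rel A.
Proof.
apply: relation_ext => v a b; rewrite rmem_converse.
by have [_ s _] := ex_relP A v; split; exact: s.
Qed.

Definition ex_id (A : ex_obj) : ex_hom A A.
Proof.
exists (ex_rel A); rewrite ?ex_rel_converse ?ex_rel_idem //; exact: rle_refl.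
Defined.

Definition ex_comp (A B D : ex_obj) (U : ex_hom B D) (T : ex_hom A B) : ex_hom A D.
Proof.
exists (rcomp HC (ex_graph U) (ex_graph T)).
- by rewrite -rcompA ex_homr.
- by rewrite rcompA ex_homl.
- rewrite converse_rcomp rcompA -(rcompA HC (converse (ex_graph T))).
  apply: rle_trans (ex_total T) _; rewrite -{2}(ex_homl T) rcompA.
  apply: rcomp_le; last exact: rle_refl.
  by apply: rcomp_le; [exact: rle_refl|exact: ex_total].
- rewrite converse_rcomp rcompA -(rcompA HC (ex_graph U)).
  apply: (rle_trans _ (ex_functional U)); rewrite -{3}(ex_homr U).
  apply: rcomp_le; last exact: rle_refl.
  by apply: rcomp_le; [exact: rle_refl|exact: ex_functional].
Defined.

Definition Ex : category.
Proof.
exists ex_obj ex_hom ex_id ex_comp.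
- by move=> A B T; apply: ex_hom_ext; exact: ex_homl.
- by move=> A B T; apply: ex_hom_ext; exact: ex_homr.
- by move=> A B D E V U T; apply: ex_hom_ext; exact: rcompA.
Defined.

End ExactCompletion.

Arguments ex_total {C HC A B} e.
Arguments ex_functional {C HC A B} e.

Section ExFunctor.
Variables (C D : category) (HC : regular_category C) (HD : regular_category D).
Variables (F : functor C D) (HF : regular_functor F).

Definition span_map (x y : C) (s : span x y) : span (F x) (F y) :=
  Span (fmap F (leg1 s)) (fmap F (leg2 s)).

Lemma jointly_monic_map (x y : C) (s : span x y) :
  jointly_monic s -> jointly_monic (span_map s).
Proof.
move=> js; have [HL _ _] := HC; have [HFL _] := HF.
have [P [p [q Pprod]]] := product_exists HL x y.
have [m [[m1 m2] _]] := Pprod _ (leg1 s) (leg2 s).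
have mm : mono m by apply/(jointly_monicP Pprod m1 m2).
have pb : is_pullback m m (idm _) (idm _).
  split=> // v a b /mm ->; exists b; split; first by rewrite comp1m.
  by move=> h [h1 _]; rewrite -h1 comp1m.
have := preserves_pullback HFL pb; rewrite !fmap1 => -[_ Fu].
have Fm : mono (fmap F m).
  move=> v f g fg; have [h [[h1 h2] _]] := Fu _ _ _ fg.
  by rewrite -h1 -h2.
apply/(jointly_monicP (preserves_product HFL Pprod)); last exact: Fm.
- by rewrite -fmapM m1.
- by rewrite -fmapM m2.
Qed.

Definition relation_map (x y : C) (R : relation x y) : relation (F x) (F y).
Proof.
exists (fun t => jointly_monic t /\
  exists2 s, rspan R s & span_equiv (span_map s) t).
have [s Rs] := rspan_ex R; exists (span_map s).
  exact/jointly_monic_map/(rspan_jm Rs).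
apply/funext => t; apply/propext.
split=> [[jt [r Rr [rt tr]]]|[jt st]]; split=> //; last by exists s.
have [_ [[k [k1 k2]] [l [l1 l2]]]] := (rspan_equiv r Rs).1 Rr.
split.
  apply: span_le_trans rt; exists (fmap F k) => /=.
  by rewrite -!fmapM k1 k2.
apply: (span_le_trans tr); exists (fmap F l) => /=.
by rewrite -!fmapM l1 l2.
Defined.

Lemma relation_map_span (x y : C) (R : relation x y) (s : span x y) :
  rspan R s -> rspan (relation_map R) (span_map s).
Proof.
move=> Rs; split; first exact/jointly_monic_map/(rspan_jm Rs).
by exists s => //; exact: span_equiv_refl.
Qed.

Lemma rmem_map (x y : C) (R : relation x y) v (a : hom v x) (b : hom v y) :
  rmem R a b -> rmem (relation_map R) (fmap F a) (fmap F b).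
Proof.
move=> [s Rs [k [<- <-]]]; exists (span_map s); first exact: relation_map_span.
by exists (fmap F k); rewrite !fmapM.
Qed.

Lemma relation_map_le (x y : C) (R T : relation x y) :
  rle R T -> rle (relation_map R) (relation_map T).
Proof.
move=> /rle_mem RT; apply/rle_mem => v a b.
have [s Rs] := rspan_ex R.
move=> /(rmemE (relation_map_span Rs)) [k [<- <-]]; apply: rmem_comp.
by apply: rmem_map; apply: RT; exact: rmem_leg.
Qed.

Lemma relation_map_converse (x y : C) (R : relation x y) :
  relation_map (converse R) = converse (relation_map R).
Proof.
have [s Rs] := rspan_ex R.
have Rs' : rspan (converse R) (span_converse s) by case: s Rs.
apply: relation_ext => v a b; rewrite rmem_converse.
rewrite (rmemE (relation_map_span Rs)) (rmemE (relation_map_span Rs')) /=.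
by split=> -[k [k1 k2]]; exists k.
Qed.

Lemma relation_map_rcomp (x y z : C) (S : relation y z) (R : relation x y) :
  relation_map (rcomp HC S R) = rcomp HD (relation_map S) (relation_map R).
Proof.
have [t ct] := rspan_ex (rcomp HC S R).
have [HFL HFe] := HF.
have [jt [r [s [w [p [q [e [[Rr Ss] pb re t1 t2]]]]]]]] := ct.
have ct' : rspan (rcomp HD (relation_map S) (relation_map R)) (span_map t).
  split; first exact: jointly_monic_map.
  exists (span_map r), (span_map s), (F w), (fmap F p), (fmap F q), (fmap F e).
  split=> /=; rewrite -?fmapM ?t1 ?t2 //.
  - by split; exact: relation_map_span.
  - exact: preserves_pullback.
  - exact: HFe.
apply: relation_ext => v a b.
by rewrite (rmemE (relation_map_span ct)) (rmemE ct').
Qed.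

Lemma relation_map_equivalence (x : C) (R : relation x x) :
  is_equivalence_relation R -> is_equivalence_relation (relation_map R).
Proof.
move=> HR v; have [HFL _] := HF; have [HL _ _] := HC.
have [s Rs] := rspan_ex R; have FRs := relation_map_span Rs; split.
- move=> a; have [r _ _] := HR x.
  have := rmem_comp a (rmem_map (r (idm x))); by rewrite fmap1 comp1m.
- move=> a b /(rmemE FRs) [k [<- <-]]; apply: rmem_comp.
  have [_ sy _] := HR (apex s).
  by apply: rmem_map; apply: sy; exact: rmem_leg.
- move=> a b c /(rmemE FRs) [k [<- kb]] /(rmemE FRs) [l [lb <-]].
  have [w [p [q pb]]] := pullback_exists HL (leg2 s) (leg1 s).
  have [_ /(_ _ k l)] := preserves_pullback HFL pb.
  case; first by rewrite (etrans kb (esym lb)).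
  move=> h [[<- <-] _] /=; rewrite !compmA -!fmapM; apply: rmem_comp.
  have [_ _ tr] := HR w; apply: rmem_map; have [c' _] := pb.
  apply: (tr _ (leg2 s \c p)); first exact/rmem_comp/rmem_leg.
  by rewrite c'; exact/rmem_comp/rmem_leg.
Qed.

Definition Ex_map_obj (A : ex_obj C) : ex_obj D :=
  ExObj (relation_map_equivalence (ex_relP A)).

Definition Ex_map_hom (A B : ex_obj C) (T : ex_hom HC A B) :
  ex_hom HD (Ex_map_obj A) (Ex_map_obj B).
Proof.
exists (relation_map (ex_graph T)) => /=.
- by rewrite -relation_map_rcomp ex_homr.
- by rewrite -relation_map_rcomp ex_homl.
- rewrite -relation_map_converse -relation_map_rcomp.
  exact/relation_map_le/ex_total.
- rewrite -relation_map_converse -relation_map_rcomp.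
  exact/relation_map_le/ex_functional.
Defined.

Definition Ex_map : functor (Ex HC) (Ex HD).
Proof.
exists (Ex_map_obj : Ex HC -> Ex HD) Ex_map_hom.
- by move=> A; exact: ex_hom_ext.
- by move=> A B E U T; apply: ex_hom_ext; exact: relation_map_rcomp.
Defined.

End ExFunctor.

Import Order.TTheory GRing.Theory Num.Theory.

Section PolishSpace.
Variables (R : realType) (T : topologicalType).
Local Open Scope ring_scope.

Definition is_metric (d : T -> T -> R) :=
  [/\ (forall x y, d x y = 0 <-> x = y),
      (forall x y, d x y = d y x) &
      (forall x y z, d x z <= d x y + d y z)].

Definition induces_topology (d : T -> T -> R) :=
  forall (x : T) (A : set T),
    nbhs x A <-> exists2 e : R, 0 < e & [set y | d x y < e] `<=` A.

Definition complete_metric (d : T -> T -> R) :=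
  forall u : nat -> T,
    (forall e : R, 0 < e -> exists N : nat, forall m n : nat,
      (N <= m)%N -> (N <= n)%N -> d (u m) (u n) < e) ->
    exists l : T, u @ \oo --> l.

Definition polish_space :=
  (exists2 D : set T, countable D & dense D) /\
  exists d : T -> T -> R,
    [/\ is_metric d, induces_topology d & complete_metric d].

End PolishSpace.

HB.mixin Record isPolishGroup (R : realType) G of Group G & Topological G := {
  mulg_continuous : continuous (fun p : G * G => (p.1 * p.2)%g);
  invg_continuous : continuous (fun x : G => (x^-1)%g);
  polish_space_subproof : polish_space R G }.

#[short(type="polishGroupType")]
HB.structure Definition PolishGroup (R : realType) :=
  {G of Group G & Topological G & isPolishGroup R G}.

Section Metric.
Variables (R : realType) (T : topologicalType) (d : T -> T -> R).
Hypotheses (dm : is_metric d) (dt : induces_topology d).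
Local Open Scope ring_scope.

Lemma metric_refl x : d x x = 0.
Proof. by have [d0 _ _] := dm; apply/d0. Qed.

Lemma metric_ge0 x y : 0 <= d x y.
Proof.
have [_ ds dtr] := dm; have := dtr x y x.
by rewrite metric_refl (ds y x) -mulr2n pmulrn_lge0.
Qed.

Lemma metric_nbhs x e : 0 < e -> nbhs x [set y | d x y < e].
Proof. by move=> e0; apply/dt; exists e. Qed.

Lemma metric_open x e : 0 < e -> open [set y | d x y < e].
Proof.
move=> e0; rewrite openE => y /= xy; apply/dt.
exists (e - d x y); first by rewrite subr_gt0.
move=> z /=; have [_ _ dtr] := dm; rewrite ltrBrDl => yz.
exact: le_lt_trans (dtr x y z) yz.
Qed.

Lemma metric_cvgP (u : nat -> T) l :
  u @ \oo --> l <-> forall e, 0 < e -> exists N, forall n, (N <= n)%N -> d l (u n) < e.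
Proof.
split=> [ul e e0|ul A /dt [e e0 eA]].
  by have [N _ NP] := ul _ (metric_nbhs l e0); exists N => n Nn; exact: NP.
by have [N NP] := ul _ e0; exists N => // n Nn; apply: eA; exact: NP.
Qed.

Lemma metric_hausdorff (x y : T) :
  (forall A B, nbhs x A -> nbhs y B -> A `&` B !=set0) -> x = y.
Proof.
have [d0 ds dtr] := dm; move=> H; apply/d0; apply: contrapT => /eqP xy.
have e0 : 0 < d x y / 2 by rewrite divr_gt0 // lt0r xy metric_ge0.
have [z [/= xz yz]] := H _ _ (metric_nbhs x e0) (metric_nbhs y e0).
have := le_lt_trans (dtr x z y) (ltrD xz (_ : d z y < d x y / 2)).
by rewrite -splitr ltxx ds yz => /(_ isT).
Qed.

End Metric.

Lemma continuous_comp_fun (T U V : topologicalType) (f : T -> U) (g : U -> V) :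
  continuous f -> continuous g -> continuous (fun x => g (f x)).
Proof. by move=> cf cg x; apply: continuous_comp; [exact: cf|exact: cg]. Qed.

Lemma continuous_pair (T U V : topologicalType) (f : T -> U) (g : T -> V) :
  continuous f -> continuous g -> continuous (fun x => (f x, g x)).
Proof. by move=> cf cg x; apply: cvg_pair; [exact: cf|exact: cg]. Qed.

Section ProductGroup.
Variables (R : realType) (G H : polishGroupType R).

Let mul_cont : continuous (fun p : (G * H) * (G * H) => (p.1 * p.2)%g).
Proof.
have fstc (T U : topologicalType) : continuous (@fst T U) by move=> x; exact: cvg_fst.
have sndc (T U : topologicalType) : continuous (@snd T U) by move=> x; exact: cvg_snd.
apply: (@continuous_pair _ _ _ (fun p : (G * H) * (G * H) => (p.1.1 * p.2.1)%g)
                              (fun p : (G * H) * (G * H) => (p.1.2 * p.2.2)%g)).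
  apply: (@continuous_comp_fun _ _ _ (fun p : (G * H) * (G * H) => (p.1.1, p.2.1))
    (fun p : G * G => (p.1 * p.2)%g)); last exact: mulg_continuous.
  apply: continuous_pair.
    exact: (continuous_comp_fun (fstc _ _) (fstc _ _)).
  exact: (continuous_comp_fun (sndc _ _) (fstc _ _)).
apply: (@continuous_comp_fun _ _ _ (fun p : (G * H) * (G * H) => (p.1.2, p.2.2))
  (fun p : H * H => (p.1 * p.2)%g)); last exact: mulg_continuous.
apply: continuous_pair.
  exact: (continuous_comp_fun (fstc _ _) (sndc _ _)).
exact: (continuous_comp_fun (sndc _ _) (sndc _ _)).
Qed.

Let inv_cont : continuous (fun x : G * H => (x^-1)%g).
Proof.
apply: (@continuous_pair _ _ _ (fun p : G * H => (p.1^-1)%g)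
                              (fun p : G * H => (p.2^-1)%g)).
  apply: continuous_comp_fun invg_continuous => x; exact: cvg_fst.
apply: continuous_comp_fun invg_continuous => x; exact: cvg_snd.
Qed.

Let prod_polish : polish_space R (G * H)%type.
Proof.
have [[D1 cD1 dD1] [d1 [m1 t1 c1]]] := @polish_space_subproof R G.
have [[D2 cD2 dD2] [d2 [m2 t2 c2]]] := @polish_space_subproof R H.
split.
  exists (D1 `*` D2); first exact: countableX.
  move=> O [[x y] Oxy] oO.
  have [[A B] /= [nA nB] AB] : nbhs (x, y) O by apply: open_nbhs_nbhs.
  have [a [Aa D1a]] : A° `&` D1 !=set0.
    by apply: dD1; [exists x|exact: open_interior].
  have [b [Bb D2b]] : B° `&` D2 !=set0.
    by apply: dD2; [exists y|exact: open_interior].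
  by exists (a, b); split=> //; apply: AB; split; exact: interior_subset.
have [[z1 s1 r1] [z2 s2 r2]] := (m1, m2).
exists (fun p q => Num.max (d1 p.1 q.1) (d2 p.2 q.2)); split.
- split.
  + move=> [x y] [x' y'] /=; split=> [e|[-> ->]].
      have h1 : (d1 x x' <= 0)%R by rewrite -e le_max lexx.
      have h2 : (d2 y y' <= 0)%R by rewrite -e le_max lexx orbT.
      congr (_, _); [apply/z1|apply/z2]; apply: le_anti.
        by rewrite h1 (metric_ge0 m1).
      by rewrite h2 (metric_ge0 m2).
    by rewrite (metric_refl m1) (metric_refl m2) maxxx.
  + by move=> p q; rewrite s1 s2.
  + move=> p q r; rewrite ge_max; apply/andP; split.
      by apply: (le_trans (r1 _ q.1 _)); rewrite lerD // le_max lexx.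
    by apply: (le_trans (r2 _ q.2 _)); rewrite lerD // le_max lexx orbT.
- move=> [x y] O; split=> [[[A B] /= [/t1 [e e0 eA] /t2 [f f0 fB]] AB]|[e e0 eO]].
    exists (Num.min e f); first by rewrite lt_min e0.
    move=> [x' y'] /=; rewrite gt_max !lt_min => /andP[/andP[h1 _] /andP[_ h2]].
    by apply: AB; split; [exact: eA|exact: fB].
  exists ([set x' | (d1 x x' < e)%R], [set y' | (d2 y y' < e)%R]).
    by split; [exact: (metric_nbhs t1)|exact: (metric_nbhs t2)].
  by move=> [x' y'] [/= h1 h2]; apply: eO => /=; rewrite gt_max h1.
- move=> u cu.
  have [l1 ul1] : exists l : G, ((u n).1 @[n --> \oo] --> l).
    apply: c1 => e /cu [N NP]; exists N => m n Nm Nn.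
    by have := NP m n Nm Nn; rewrite gt_max => /andP[].
  have [l2 ul2] : exists l : H, ((u n).2 @[n --> \oo] --> l).
    apply: c2 => e /cu [N NP]; exists N => m n Nm Nn.
    by have := NP m n Nm Nn; rewrite gt_max => /andP[].
  exists (l1, l2).
  move=> O [[A B] /= [nA nB] AB].
  have [N1 _ h1] := ul1 _ nA; have [N2 _ h2] := ul2 _ nB.
  exists (maxn N1 N2) => // n /=; rewrite geq_max => /andP[n1 n2].
  by apply: AB; split; [exact: h1|exact: h2].
Qed.

HB.instance Definition _ :=
  isPolishGroup.Build R (G * H)%type mul_cont inv_cont prod_polish.

End ProductGroup.

Section Category.
Variable R : realType.

Record polish_hom (G H : polishGroupType R) := PolishHom {
  polish_fun :> G -> H;
  polish_funM : {morph polish_fun : x y / (x * y)%g};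
  polish_fun_continuous : continuous polish_fun }.

Lemma polish_hom_ext (G H : polishGroupType R) (f g : polish_hom G H) :
  f =1 g -> f = g.
Proof.
case: f g => [f fM fc] [g gM gc] /= /funext fg; subst g.
by congr PolishHom; exact: Prop_irrelevance.
Qed.

Definition polish_id (G : polishGroupType R) : polish_hom G G.
Proof. by exists id => // x; exact: cvg_id. Defined.

Definition polish_comp (G H K : polishGroupType R) (g : polish_hom H K)
  (f : polish_hom G H) : polish_hom G K.
Proof.
exists (g \o f) => [x y|] /=; first by rewrite !polish_funM.
by apply: continuous_comp_fun; exact: polish_fun_continuous.
Defined.

Definition Polish : category.
Proof.
by exists (polishGroupType R) polish_hom polish_id polish_comp => *;
  apply: polish_hom_ext.
Defined.

Definition polish_trivial (G H : polishGroupType R) : polish_hom G H.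
Proof. by exists (fun=> 1%g) => [x y|x]; [rewrite mulg1|exact: cvg_cst]. Defined.

Definition polish_fst (G H : polishGroupType R) : polish_hom (G * H)%type G.
Proof. by exists fst => // x; exact: cvg_fst. Defined.

Definition polish_snd (G H : polishGroupType R) : polish_hom (G * H)%type H.
Proof. by exists snd => // x; exact: cvg_snd. Defined.

Definition polish_pair (K G H : polishGroupType R) (f : polish_hom K G)
  (g : polish_hom K H) : polish_hom K (G * H)%type.
Proof.
exists (fun x => (f x, g x)) => [x y|]; first by rewrite !polish_funM.
by apply: continuous_pair; exact: polish_fun_continuous.
Defined.

End Category.

Lemma polish_fun1 (R : realType) (G H : polishGroupType R) (f : polish_hom G H) :
  f 1%g = 1%g.
Proof. by apply: (@mulgI _ (f 1%g)); rewrite -polish_funM !mulg1. Qed.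

Lemma polish_funV (R : realType) (G H : polishGroupType R) (f : polish_hom G H) x :
  f (x^-1)%g = (f x)^-1%g.
Proof. by apply: (@mulgI _ (f x)); rewrite -polish_funM !mulgV polish_fun1. Qed.

Section Equalizer.
Variables (R : realType) (G H : polishGroupType R) (f g : polish_hom G H).

Definition equalizer := set_type [set x : G | f x = g x].

HB.instance Definition _ := Topological.on equalizer.

Let eP (x : equalizer) : f (set_val x) = g (set_val x).
Proof. by rewrite set_valE; exact: (set_mem (valP x)). Qed.

Let mk (x : G) (xP : f x = g x) : equalizer := exist _ x (mem_set xP).

Let one_subproof : f 1%g = g 1%g.
Proof. by rewrite !polish_fun1. Qed.
Let mul_subproof (x y : equalizer) :
  f (set_val x * set_val y)%g = g (set_val x * set_val y)%g.
Proof. by rewrite !polish_funM !eP. Qed.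
Let inv_subproof (x : equalizer) : f ((set_val x)^-1)%g = g ((set_val x)^-1)%g.
Proof. by rewrite !polish_funV eP. Qed.

Let eone : equalizer := mk one_subproof.
Let emul (x y : equalizer) : equalizer := mk (mul_subproof x y).
Let einv (x : equalizer) : equalizer := mk (inv_subproof x).

Let val_inj' : injective (set_val : equalizer -> G).
Proof. by move=> x y; rewrite !set_valE => /val_inj. Qed.
Let mkK x xP : set_val (@mk x xP) = x.
Proof. by rewrite set_valE. Qed.

Let emulA : associative emul.
Proof. by move=> x y z; apply: val_inj'; rewrite !mkK mulgA. Qed.
Let emul1 : left_id eone emul.
Proof. by move=> x; apply: val_inj'; rewrite !mkK mul1g. Qed.
Let e1mul : right_id eone emul.
Proof. by move=> x; apply: val_inj'; rewrite !mkK mulg1. Qed.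
Let emulV : left_inverse eone einv emul.
Proof. by move=> x; apply: val_inj'; rewrite !mkK mulVg. Qed.
Let eVmul : right_inverse eone einv emul.
Proof. by move=> x; apply: val_inj'; rewrite !mkK mulgV. Qed.

HB.instance Definition _ :=
  isGroup.Build equalizer emulA emul1 e1mul emulV eVmul.

Let val_cont : continuous (set_val : equalizer -> G).
Proof. exact: initial_continuous. Qed.

Let nbhs_equalizer (x : equalizer) (A : set equalizer) :
  nbhs x A <-> exists2 B, nbhs (set_val x) B & set_val @^-1` B `<=` A.
Proof.
split=> [[_ [[U oU <-] Ux UA]]|[B nB BA]].
  exists U; last exact: UA.
  by rewrite nbhsE; exists U.
by apply: (filterS BA); exact: (val_cont nB).
Qed.

Let continuous_to (T : topologicalType) (h : T -> equalizer) :
  continuous (set_val \o h) -> continuous h.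
Proof.
move=> hc x A /nbhs_equalizer [B nB BA].
have nB' := hc x _ nB; apply: (@filterS _ _ _ ((set_val \o h) @^-1` B)) nB'.
by move=> y; exact: BA.
Qed.

Let mul_cont : continuous (fun p : equalizer * equalizer => (p.1 * p.2)%g).
Proof.
apply: continuous_to.
apply: (@continuous_comp_fun _ _ _
  (fun p : equalizer * equalizer => (set_val p.1, set_val p.2))
  (fun p : G * G => (p.1 * p.2)%g)); last exact: mulg_continuous.
apply: continuous_pair.
  by apply: continuous_comp_fun val_cont => x; exact: cvg_fst.
by apply: continuous_comp_fun val_cont => x; exact: cvg_snd.
Qed.

Let inv_cont : continuous (fun x : equalizer => (x^-1)%g).
Proof.
by apply: continuous_to; apply: continuous_comp_fun val_cont invg_continuous.
Qed.

Let equalizer_polish : polish_space R equalizer.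
Proof.
have [[D cD dD] [d [m t c]]] := @polish_space_subproof R G.
have [d0 ds dtr] := m.
split.
  pose P (p : G * nat) (x : equalizer) := (d (set_val x) p.1 < p.2.+1%:R^-1)%R.
  pose sel (p : G * nat) : equalizer :=
    if pselect (exists x, P p x) is left h then projT1 (cid h) else 1%g.
  have selP p x : P p x -> P p (sel p).
    rewrite /sel => Px; case: pselect => [h|[]]; last by exists x.
    exact: (projT2 (cid h)).
  exists (sel @` (D `*` [set: nat])).
    apply: sub_countable (card_image_le _ _) _.
    by apply: countableX => //; exact: countableP.
  move=> O [x Ox] oO.
  have /nbhs_equalizer [B /t [e e0 eB] BO] : nbhs x O by exact: open_nbhs_nbhs.
  have [N NP] : exists N : nat, (N.+1%:R^-1 + N.+1%:R^-1 < e)%R.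
    have e2 : (0 < e / 2)%R by rewrite divr_gt0.
    exists (Num.bound (e / 2)^-1); rewrite [ltRHS]splitr.
    suff h : (((Num.bound (e / 2)^-1).+1)%:R^-1 < e / 2)%R by rewrite ltrD.
    rewrite invf_plt ?posrE // (lt_trans (archi_boundP _)) ?invr_ge0 ?ltW //.
    by rewrite ltr_nat.
  have N0 : (0 < (N.+1%:R : R)^-1)%R by rewrite invr_gt0.
  have [q [/= xq Dq]] : [set y | (d (set_val x) y < N.+1%:R^-1)%R] `&` D !=set0.
    apply: dD; last exact: metric_open.
    by exists (set_val x); rewrite /= metric_refl.
  have Pq : P (q, N) x by [].
  have := selP _ _ Pq; rewrite /P /= => sq.
  exists (sel (q, N)); split; last by exists (q, N).
  apply: BO; apply: eB => /=; apply: le_lt_trans (dtr _ q _) _.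
  by rewrite (ds q); apply: lt_trans NP; rewrite ltrD.
exists (fun x y => d (set_val x) (set_val y)); split.
- split=> [x y|x y|x y z]; [|exact: ds|exact: dtr].
  by split=> [/d0 /val_inj'|->]; last exact/d0.
- move=> x A; split=> [/nbhs_equalizer [B /t [e e0 eB] BA]|[e e0 eA]].
    by exists e => // y xy; apply: BA; exact: eB.
  apply/nbhs_equalizer; exists [set y | (d (set_val x) y < e)%R].
    exact: metric_nbhs.
  by move=> y; exact: eA.
- move=> u cu; have [l ul] := c (fun n => set_val (u n)) cu.
  have lP : f l = g l.
    have [_ [dH [mH tH _]]] := @polish_space_subproof R H.
    apply: (metric_hausdorff mH tH) => A B nA nB.
    have [N1 _ h1] := ul _ (@polish_fun_continuous _ _ _ f l _ nA).
    have [N2 _ h2] := ul _ (@polish_fun_continuous _ _ _ g l _ nB).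
    exists (f (set_val (u (maxn N1 N2)))); split.
      by apply: h1; exact: leq_maxl.
    by rewrite eP; apply: h2; exact: leq_maxr.
  exists (mk lP) => A /nbhs_equalizer [B]; rewrite mkK => nB BA.
  have [N _ NP] := ul _ nB; exists N => // n Nn.
  by apply: BA; exact: NP.
Qed.

HB.instance Definition _ :=
  isPolishGroup.Build R equalizer mul_cont inv_cont equalizer_polish.

Definition equalizer_incl : polish_hom equalizer G.
Proof. by exists set_val => [x y|]; [rewrite mkK|exact: val_cont]. Defined.

Lemma equalizer_incl_inj : injective equalizer_incl.
Proof. exact: val_inj'. Qed.

Lemma equalizer_inclP (x : equalizer) : f (equalizer_incl x) = g (equalizer_incl x).
Proof. exact: eP. Qed.

Lemma equalizer_incl_ex (x : G) : f x = g x -> exists y, equalizer_incl y = x.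
Proof. by move=> xP; exists (mk xP); exact: mkK. Qed.

End Equalizer.

Local Open Scope quotient_scope.

Definition is_normal_subgroup (G : groupType) (N : set G) :=
  [/\ N 1%g,
      (forall x y, N x -> N y -> N (x * y)%g),
      (forall x, N x -> N (x^-1)%g) &
      (forall x g, N x -> N (g^-1 * x * g)%g)].

(* N is the image of an injective continuous homomorphism i from a Polish
   group K; the Polish topology of N is the one transported from K along i. *)
Definition is_polish_subgroup (R : realType) (G : polishGroupType R) (N : set G) :=
  exists (K : polishGroupType R) (i : polish_hom K G), injective i /\ range i = N.

Record polish_cover (R : realType) := PolishCover {
  cover_group : polishGroupType R;
  cover_kernel : set cover_group;
  cover_kernel_normal : is_normal_subgroup cover_kernel;
  cover_kernel_polish : is_polish_subgroup cover_kernel }.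

Section Quotient.
Variables (R : realType) (Q : polish_cover R).

Definition same_coset (x y : cover_group Q) : bool := `[< cover_kernel (x^-1 * y)%g >].

Let same_coset_refl : reflexive same_coset.
Proof. by move=> x; apply/asboolP; rewrite mulVg; have [] := cover_kernel_normal Q. Qed.

Let same_coset_sym : symmetric same_coset.
Proof.
have [_ _ NV _] := cover_kernel_normal Q.
by move=> x y; apply/asboolP/asboolP => /NV; rewrite invgM invgK.
Qed.

Let same_coset_trans : transitive same_coset.
Proof.
have [_ NM _ _] := cover_kernel_normal Q.
move=> y x z /asboolP xy /asboolP yz; apply/asboolP.
by have := NM _ _ xy yz; rewrite mulgA mulgK.
Qed.

Canonical same_coset_equiv :=
  EquivRel same_coset same_coset_refl same_coset_sym same_coset_trans.

Definition quo : Type := {eq_quot same_coset_equiv}.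
HB.instance Definition _ := Choice.on quo.
HB.instance Definition _ := EqQuotient.on quo.

Definition coset_of (x : cover_group Q) : quo := \pi_quo x.

Lemma coset_ofP (x y : cover_group Q) : coset_of x = coset_of y <-> cover_kernel (x^-1 * y)%g.
Proof.
by split=> [/eqP|xy]; [rewrite eqmodE => /asboolP|apply/eqmodP/asboolP].
Qed.

Lemma coset_of_surj (a : quo) : exists x, coset_of x = a.
Proof. by exists (repr a); exact: reprK. Qed.

Let qone : quo := coset_of 1%g.
Let qmul (a b : quo) : quo := coset_of (repr a * repr b)%g.
Let qinv (a : quo) : quo := coset_of (repr a)^-1%g.

Let repr_coset (x : cover_group Q) : cover_kernel ((repr (coset_of x))^-1 * x)%g.
Proof. by apply/coset_ofP; exact: reprK. Qed.

Let qmulE (x y : cover_group Q) : qmul (coset_of x) (coset_of y) = coset_of (x * y)%g.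
Proof.
have [_ NM _ NJ] := cover_kernel_normal Q; apply/coset_ofP.
have := NM _ _ (repr_coset y) (NJ _ y (repr_coset x)).
by rewrite invgM !mulgA mulgK.
Qed.

Let qinvE (x : cover_group Q) : qinv (coset_of x) = coset_of (x^-1)%g.
Proof.
have [_ _ NV NJ] := cover_kernel_normal Q; apply/coset_ofP.
have := NJ _ (x^-1)%g (NV _ (repr_coset x)).
by rewrite invgM !invgK !mulgA mulgV mul1g.
Qed.

Let qmulA : associative qmul.
Proof.
move=> a b c; have [x <-] := coset_of_surj a; have [y <-] := coset_of_surj b.
by have [z <-] := coset_of_surj c; rewrite !qmulE mulgA.
Qed.
Let qmul1 : left_id qone qmul.
Proof. by move=> a; have [x <-] := coset_of_surj a; rewrite qmulE mul1g. Qed.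
Let q1mul : right_id qone qmul.
Proof. by move=> a; have [x <-] := coset_of_surj a; rewrite qmulE mulg1. Qed.
Let qmulV : left_inverse qone qinv qmul.
Proof. by move=> a; have [x <-] := coset_of_surj a; rewrite qinvE qmulE mulVg. Qed.
Let qVmul : right_inverse qone qinv qmul.
Proof. by move=> a; have [x <-] := coset_of_surj a; rewrite qinvE qmulE mulgV. Qed.

HB.instance Definition _ := isGroup.Build quo qmulA qmul1 q1mul qmulV qVmul.

Lemma coset_ofM (x y : cover_group Q) :
  coset_of (x * y)%g = (coset_of x * coset_of y)%g.
Proof. by rewrite -[RHS]/(qmul _ _) qmulE. Qed.

(* E_N^G, as a subset of G x G. *)
Definition coset_relation : set (cover_group Q * cover_group Q) :=
  [set p | coset_of p.1 = coset_of p.2].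

End Quotient.

Definition borel_fun (T U : topologicalType) (f : T -> U) :=
  forall B : set U, <<s @open U >> B -> <<s @open T >> (f @^-1` B).

Section PCCategory.
Variable R : realType.

Record borel_definable_hom (P Q : polish_cover R) := BorelDefinableHom {
  bdh_fun :> quo P -> quo Q;
  bdh_funM : {morph bdh_fun : x y / (x * y)%g};
  bdh_lift : exists2 f : cover_group P -> cover_group Q, borel_fun f &
    forall g, bdh_fun (coset_of g) = coset_of (f g) }.

Lemma bdh_ext (P Q : polish_cover R) (f g : borel_definable_hom P Q) :
  f =1 g -> f = g.
Proof.
case: f g => [f fM fl] [g gM gl] /= /funext fg; subst g.
by congr BorelDefinableHom; exact: Prop_irrelevance.
Qed.

Definition bdh_id (P : polish_cover R) : borel_definable_hom P P.
Proof. by exists id => //; exists id. Defined.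

Definition bdh_comp (P Q S : polish_cover R) (g : borel_definable_hom Q S)
  (f : borel_definable_hom P Q) : borel_definable_hom P S.
Proof.
exists (g \o f) => [x y|] /=; first by rewrite !bdh_funM.
have [f' f'b f'P] := bdh_lift f; have [g' g'b g'P] := bdh_lift g.
exists (g' \o f') => [B /g'b /f'b //|x] /=.
by rewrite f'P g'P.
Defined.

Definition PC : category.
Proof.
by exists (polish_cover R) borel_definable_hom bdh_id bdh_comp => *; exact: bdh_ext.
Defined.

End PCCategory.

Section JointlyInjective.
Variable R : realType.
Implicit Types G H : polishGroupType R.

Lemma jointly_monic_injective G H (s : @span (Polish R) G H) :
  jointly_monic s ->
  forall x y : apex s, leg1 s x = leg1 s y -> leg2 s x = leg2 s y -> x = y.
Proof.
move=> js x y xy1 xy2.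
pose m := polish_pair (leg1 s) (leg2 s).
pose A := (apex s : polishGroupType R).
pose i := equalizer_incl (polish_comp m (polish_fst A A)) (polish_comp m (polish_snd A A)).
have iP z : leg1 s (i z).1 = leg1 s (i z).2 /\ leg2 s (i z).1 = leg2 s (i z).2.
  by have [] := equalizer_inclP z.
have e : polish_comp (polish_fst A A) i = polish_comp (polish_snd A A) i.
  by apply: js; apply: polish_hom_ext => z /=; have [] := iP z.
have [z zP] : exists z, i z = (x, y).
  by apply: equalizer_incl_ex; congr (_, _).
have : (i z).1 = (i z).2 := congr1 (fun h : polish_hom _ A => h z) e.
by rewrite zP.
Qed.

Definition related G H (T : @relation (Polish R) G H) (g : G) (h : H) :=
  exists2 s, rspan T s & exists t : apex s, leg1 s t = g /\ leg2 s t = h.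

Lemma relatedE G H (T : @relation (Polish R) G H) s : rspan T s ->
  forall g h, related T g h <-> exists t : apex s, leg1 s t = g /\ leg2 s t = h.
Proof.
move=> Ts g h; split=> [[r Tr [t [<- <-]]]|]; last by exists s.
have [_ [_ [k [k1 k2]]]] := (rspan_equiv r Ts).1 Tr.
by exists (polish_fun k t); rewrite -k1 -k2.
Qed.

Lemma rmem_related G H K (T : @relation (Polish R) G H)
    (a : polish_hom K G) (b : polish_hom K H) :
  @rmem (Polish R) _ _ T K a b -> forall x, related T (a x) (b x).
Proof.
by move=> [s Ts [k [<- <-]]] x; exists s => //; exists (polish_fun k x).
Qed.

End JointlyInjective.

Section CanonicalObject.
Variables (R : realType) (A : ex_obj (Polish R)).

Definition ex_kernel : set (ex_base A : polishGroupType R) :=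
  [set n | related (ex_rel A) 1%g n].

Lemma ex_kernel_normal : is_normal_subgroup ex_kernel.
Proof.
have [s Rs] := rspan_ex (ex_rel A).
split.
- by apply/(relatedE Rs); exists 1%g; rewrite !polish_fun1.
- move=> x y /(relatedE Rs) [t [t1 t2]] /(relatedE Rs) [u [u1 u2]].
  by apply/(relatedE Rs); exists (t * u)%g; rewrite !polish_funM t1 t2 u1 u2 mulg1.
- move=> x /(relatedE Rs) [t [t1 t2]].
  by apply/(relatedE Rs); exists (t^-1)%g; rewrite !polish_funV t1 t2 invg1.
- move=> x g /(relatedE Rs) [t [t1 t2]]; apply/(relatedE Rs).
  have [r _ _] := ex_relP A (ex_base A).
  have /(relatedE Rs) [u [u1 u2]] := rmem_related (r (polish_id _)) g.
  exists (u^-1 * t * u)%g; rewrite !polish_funM !polish_funV t1 t2 u1 u2 /=.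
  by rewrite mulg1 mulVg.
Qed.

Lemma ex_kernel_polish : is_polish_subgroup ex_kernel.
Proof.
have [s Rs] := rspan_ex (ex_rel A).
pose i := equalizer_incl (leg1 s : polish_hom _ _) (polish_trivial _ _).
exists (equalizer (leg1 s : polish_hom _ _) (polish_trivial _ _)),
  (polish_comp (leg2 s : polish_hom _ _) i); split.
  move=> x y /= xy; apply: equalizer_incl_inj.
  apply: (jointly_monic_injective (rspan_jm Rs)) xy.
  exact: (etrans (equalizer_inclP x) (esym (equalizer_inclP y))).
apply/seteqP; split=> [_ [x _ <-]|n /(relatedE Rs) [t [t1 t2]]] /=.
  by apply/(relatedE Rs); exists (i x); split=> //; exact: (equalizer_inclP x).
have [z zt] := @equalizer_incl_ex _ _ _ (leg1 s : polish_hom _ _) (polish_trivial _ _) t t1.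
by exists z => //; rewrite -t2 -zt.
Qed.

Definition ex_cover : polish_cover R :=
  PolishCover ex_kernel_normal ex_kernel_polish.

(* The internal equivalence relation of A is E_N^G. *)
Lemma ex_coverP (g h : cover_group ex_cover) :
  coset_relation (g, h) <-> related (ex_rel A) g h.
Proof.
have [s Rs] := rspan_ex (ex_rel A).
have [r _ _] := ex_relP A (ex_base A).
have /(relatedE Rs) [u [u1 u2]] := rmem_related (r (polish_id _)) g.
rewrite /coset_relation /= coset_ofP /=.
split=> /(relatedE Rs) [t [t1 t2]]; apply/(relatedE Rs).
  by exists (u * t)%g; rewrite !polish_funM u1 u2 t1 t2 /= mulg1 mulVKg.
by exists (u^-1 * t)%g; rewrite !polish_funM !polish_funV u1 u2 t1 t2 /= mulVg.
Qed.

End CanonicalObject.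

Section CanonicalFunctor.
Variables (R : realType) (HP : regular_category (Polish R)).

(* The canonical functor Ex(P) -> PC: it sends (G, E_N^G) to G/N and T to the
   homomorphism f_T with f_T(gN) = hM whenever (g, h) is in T; this condition
   determines the action on morphisms. *)
Record canonical_functor := CanonicalFunctor {
  cf_map : forall A B : Ex HP, hom A B ->
    borel_definable_hom (ex_cover A) (ex_cover B);
  cf_map1 : forall A : Ex HP, cf_map (idm A) = bdh_id (ex_cover A);
  cf_mapM : forall (A B D : Ex HP) (U : hom B D) (T : hom A B),
    cf_map (U \c T) = bdh_comp (cf_map U) (cf_map T);
  cf_coset : forall (A B : Ex HP) (T : hom A B)
    (g : cover_group (ex_cover A)) (h : cover_group (ex_cover B)),
    related (ex_graph T) g h -> cf_map T (coset_of g) = coset_of h }.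

Definition functor_of_canonical (E : canonical_functor) : functor (Ex HP) (PC R) :=
  @Functor (Ex HP) (PC R) (@ex_cover R) (cf_map E) (cf_map1 E) (cf_mapM E).

End CanonicalFunctor.

Coercion functor_of_canonical : canonical_functor >-> functor.

Section Thick.
Variable R : realType.
Implicit Types X Y K : Polish R.

Definition regular_subcategory (C : category) (S : C -> Prop) :=
  regular_category (full_subcategory S) /\ regular_functor (inclusion S).

Definition essentially (C : category) (S : C -> Prop) (x : C) :=
  exists2 y, S y & isomorphic x y.

Definition is_kernel (K X Y : polishGroupType R) (k : polish_hom K X)
    (q : polish_hom X Y) :=
  polish_comp q k = polish_trivial K Y /\
  forall (Z : polishGroupType R) (h : polish_hom Z X),
    polish_comp q h = polish_trivial Z Y ->
    exists! l : polish_hom Z K, polish_comp k l = h.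

Definition short_exact (K X Y : polishGroupType R) (k : polish_hom K X)
    (q : polish_hom X Y) :=
  range q = [set: Y] /\ is_kernel k q.

Definition thick (S : Polish R -> Prop) :=
  regular_subcategory S /\
  forall (A X : Polish R) (i : hom X A), S A -> mono i ->
  forall (K Y : polishGroupType R) (k : polish_hom K X) (q : polish_hom X Y),
    short_exact k q ->
    essentially S X <-> essentially S (K : Polish R) /\ essentially S (Y : Polish R).

(* E_N^G is in S up to isomorphism when some Polish group in S (up to
   isomorphism) admits an injective continuous homomorphism to G x G with
   image E_N^G. *)
Definition S_cover (S : Polish R -> Prop) (Q : PC R) :=
  essentially S (cover_group Q : Polish R) /\
  exists (K : polishGroupType R) (i : polish_hom K (cover_group Q * cover_group Q)%type),
    [/\ injective i, range i = @coset_relation R Q & essentially S (K : Polish R)].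

Definition thick_regular (S : Polish R -> Prop) (HS : thick S) :
  regular_category (full_subcategory S) := HS.1.1.

Definition Ex_inclusion (HP : regular_category (Polish R)) (S : Polish R -> Prop)
    (HS : thick S) : functor (Ex (thick_regular HS)) (Ex HP) :=
  Ex_map (thick_regular HS) HP HS.1.2.

End Thick.

(* Main.v *)
(* Fullness of Ex(S) -> Ex(P): a morphism T from (G, E_N^G) to (H, E_M^H) is a
   Polish subgroup of G x H, the first projection T -> G is surjective, and its
   kernel is the same subgroup M of H as the kernel of the first projection
   E_M^H -> H. Thickness puts M in S, as the kernel of E_M^H -> H, and then T,
   as an extension of G by M.
   Essential image: if G and E_N^G are in S, then E_N^G is an internal
   equivalence relation in S, because a continuous homomorphism whose range lies
   in a Polish subgroup is continuous into that subgroup. This follows from the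
   open mapping theorem for Polish groups. *)
From HB Require Import structures.
From mathcomp Require Import all_boot all_order all_algebra.
From mathcomp Require Import all_classical reals topology measurable_structure.
Require Import Defs.

Set Implicit Arguments.
Unset Strict Implicit.
Unset Printing Implicit Defensive.

Import Order.TTheory GRing.Theory Num.Theory.

Local Open Scope classical_set_scope.

(** * Equivalences of categories; relations along full functors *)

Definition faithful (C D : category) (F : functor C D) :=
  forall (x y : C) (f g : hom x y), fmap F f = fmap F g -> f = g.

Definition full (C D : category) (F : functor C D) :=
  forall (x y : C) (h : hom (F x) (F y)), exists f : hom x y, fmap F f = h.

Lemma iso_inj (C : category) (x y z : C) (e : hom x y) (f g : hom y z) :
  is_iso e -> f \c e = g \c e -> f = g.
Proof.
by move=> [e' [_ ee']] fg; rewrite -(compm1 f) -(compm1 g) -ee' !compmA fg.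
Qed.

(** Naturality gives [f \c eta x = eta y \c fmap G (fmap F f)], so [fmap F f] determines [f] once
    the isomorphism [eta x] is cancelled. *)
Lemma naturally_isomorphic_id_faithful (C D : category) (F : functor C D)
    (G : functor D C) :
  naturally_isomorphic (functor_comp G F) (functor_id C) -> faithful F.
Proof.
move=> [eta ei en] x y f g fg; apply: (iso_inj (ei x)).
by have := en _ _ f; have := en _ _ g; rewrite /= fg => -> ->.
Qed.

Lemma equivalence_faithful (C D : category) (F : functor C D) :
  is_equivalence F -> faithful F.
Proof. by move=> [G [GF _]]; exact: naturally_isomorphic_id_faithful GF. Qed.

(** The preimage of [h] is [fmap G h] conjugated by [eta]. Since [G] is faithful too, it is enough
    to compare images under [G], where naturality of [eta] applies. *)
Lemma equivalence_full (C D : category) (F : functor C D) :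
  is_equivalence F -> full F.
Proof.
move=> [G [[eta ei en] FG]] x y h.
have [e' [e'e ee']] := ei x.
exists (eta y \c fmap G h \c e').
apply: (naturally_isomorphic_id_faithful FG).
have [d [dd' d'd]] := ei y.
have := en _ _ (eta y \c fmap G h \c e').
rewrite /= -compmA e'e compm1 => /(congr1 (comp d)).
by rewrite !compmA dd' !comp1m => /esym.
Qed.

(** Choice selects for each [y] an isomorphism [e y] from some [F (Go y)] onto [y]. The inverse
    functor conjugates by [e] and lifts along [F]; its laws are checked after applying the faithful
    [F]. *)
Lemma equivalence_of_full_faithful (C D : category) (F : functor C D) :
  full F -> faithful F -> (forall y, exists x, isomorphic (F x) y) ->
  is_equivalence F.
Proof.
move=> Ffull Ff Fes.
pose Go y := projT1 (cid (Fes y)).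
pose e y : hom (F (Go y)) y := projT1 (cid (projT2 (cid (Fes y)))).
have eP y : is_iso (e y) := projT2 (cid (projT2 (cid (Fes y)))).
pose e' y := projT1 (cid (eP y)).
have e'e y : e' y \c e y = idm _ by have [] := projT2 (cid (eP y)).
have ee' y : e y \c e' y = idm _ by have [] := projT2 (cid (eP y)).
pose pre x y (h : hom (F x) (F y)) := projT1 (cid (Ffull x y h)).
have preP x y (h : hom (F x) (F y)) : fmap F (pre x y h) = h.
  exact: projT2 (cid (Ffull x y h)).
pose Gm y z (h : hom y z) : hom (Go y) (Go z) := pre _ _ (e' z \c h \c e y).
have Gm1 y : Gm y y (idm y) = idm _.
  by apply: Ff; rewrite preP fmap1 compm1 e'e.
have GmM x y z (g : hom y z) (f : hom x y) :
    Gm _ _ (g \c f) = Gm _ _ g \c Gm _ _ f.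
  apply: Ff; rewrite fmapM !preP !compmA.
  by rewrite -(compmA (e' z \c g) (e y)) ee' compm1.
exists (Functor Gm1 GmM); split.
  exists (fun x => pre (Go (F x)) x (e (F x))) => [x|x y f] /=.
    exists (pre x (Go (F x)) (e' (F x))).
    by split; apply: Ff; rewrite fmapM !preP ?fmap1.
  by apply: Ff; rewrite !fmapM !preP !compmA ee' comp1m.
exists e => // x y f /=.
by rewrite preP !compmA ee' comp1m.
Qed.

Lemma functor_comp_full (C D B : category) (G : functor D B) (F : functor C D) :
  full G -> full F -> full (functor_comp G F).
Proof.
move=> Gf Ff x y h; have [g <-] := Gf _ _ h; have [f <-] := Ff _ _ g.
by exists f.
Qed.

Lemma functor_comp_faithful (C D B : category) (G : functor D B) (F : functor C D) :
  faithful G -> faithful F -> faithful (functor_comp G F).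
Proof. by move=> Gf Ff x y f g /Gf /Ff. Qed.

Lemma rle_anti (C : category) (x y : C) (R T : relation x y) :
  rle R T -> rle T R -> R = T.
Proof. by move=> /rle_mem RT /rle_mem TR; apply: relation_ext => v a b; split; auto. Qed.

(** * Reflection of relations along a fully faithful regular functor *)

Section FullyFaithfulRelations.
Variables (C D : category) (HC : regular_category C) (HD : regular_category D).
Variables (F : functor C D) (HF : regular_functor F).
Hypotheses (Ffull : full F) (Ff : faithful F).

Lemma span_map_le_inv (x y : C) (s t : span x y) :
  span_le (span_map F s) (span_map F t) -> span_le s t.
Proof.
move=> [k]; have [k0 <-] := Ffull k => -[/=]; rewrite -!fmapM => k1 k2.
by exists k0; split; exact: Ff.
Qed.

Lemma relation_map_le_inv (x y : C) (R T : relation x y) :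
  rle (relation_map HC HF R) (relation_map HC HF T) -> rle R T.
Proof.
move=> RT s Rs; have [t Tt] := rspan_ex T; exists t => //.
have FTt := relation_map_span HC HF Tt.
have [u FTu su] := RT _ (relation_map_span HC HF Rs).
have [_ [_ ut]] := (rspan_equiv u FTt).1 FTu.
by apply: span_map_le_inv; exact: span_le_trans su ut.
Qed.

Lemma relation_map_inj (x y : C) : injective (@relation_map C D HC F HF x y).
Proof.
by move=> R T RT; apply: rle_anti; apply: relation_map_le_inv; rewrite RT; exact: rle_refl.
Qed.

Lemma jointly_monic_map_inv (x y : C) (s : span x y) :
  jointly_monic (span_map F s) -> jointly_monic s.
Proof. by move=> js w f g fg1 fg2; apply/Ff/js; rewrite /= -!fmapM ?fg1 ?fg2. Qed.

(** Once the apex is moved into the image of [F], fullness lifts both legs and faithfulness reflects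
    joint monicity. *)
Lemma relation_map_onto (x y z : C) (T : relation (F x) (F y)) (s : span (F x) (F y)) :
  rspan T s -> isomorphic (apex s) (F z) ->
  exists R : relation x y, relation_map HC HF R = T.
Proof.
move=> Ts [e [e' [e'e ee']]].
have [l l1] := Ffull (leg1 s \c e'); have [m m1] := Ffull (leg2 s \c e').
have eq1 : span_equiv s (span_map F (Span l m)).
  split; [exists e|exists e'] => //=.
  by rewrite l1 m1 -!compmA e'e !compm1.
have js : jointly_monic (Span l m).
  apply: jointly_monic_map_inv => w f g /=; rewrite l1 m1 -!compmA => fg1 fg2.
  rewrite -(comp1m f) -(comp1m g) -ee' -!compmA; congr (_ \c _).
  exact: (rspan_jm Ts).
exists (relation_of js); apply: relation_ext => v a b.
rewrite (rmemE (relation_map_span HC HF (_ : rspan (relation_of js) (Span l m)))).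
  by rewrite (rmemE ((rspan_equiv _ Ts).2 (conj (jointly_monic_map HC HF js) eq1))).
by split=> //; exact: span_equiv_refl.
Qed.

Lemma Ex_map_faithful : faithful (Ex_map HC HD HF).
Proof.
move=> A B T U TU; apply: ex_hom_ext; apply: relation_map_inj.
exact: (congr1 (fun V : ex_hom HD _ _ => ex_graph V) TU).
Qed.

(** [relation_map] commutes with composition and converse, is injective and reflects inclusion, so
    the four conditions on a morphism descend from [T] to [U]. Fullness on exact completions thus
    reduces to finding the apex. *)
Lemma Ex_map_hom_onto (A B : Ex HC)
    (T : hom (Ex_map HC HD HF A) (Ex_map HC HD HF B))
    (s : span (F (ex_base A)) (F (ex_base B))) (z : C) :
  rspan (ex_graph T) s -> isomorphic (apex s) (F z) ->
  exists U : hom A B, fmap (Ex_map HC HD HF) U = T.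
Proof.
move=> Ts sz; have [U UT] := relation_map_onto Ts sz.
have Ur : rcomp HC U (ex_rel A) = U.
  apply: relation_map_inj; rewrite (relation_map_rcomp HC HD HF) UT.
  exact: (ex_homr T).
have Ul : rcomp HC (ex_rel B) U = U.
  apply: relation_map_inj; rewrite (relation_map_rcomp HC HD HF) UT.
  exact: (ex_homl T).
have Ut : rle (ex_rel A) (rcomp HC (converse U) U).
  apply: relation_map_le_inv.
  rewrite (relation_map_rcomp HC HD HF) relation_map_converse UT.
  exact: (ex_total T).
have Uf : rle (rcomp HC U (converse U)) (ex_rel B).
  apply: relation_map_le_inv.
  rewrite (relation_map_rcomp HC HD HF) relation_map_converse UT.
  exact: (ex_functional T).
by exists (ExHom Ur Ul Ut Uf); exact: ex_hom_ext.
Qed.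

End FullyFaithfulRelations.

Section Essentially.
Variables (C : category) (S : C -> Prop).

Lemma isomorphic_refl (x : C) : isomorphic x x.
Proof. by exists (idm x), (idm x); rewrite !comp1m. Qed.

Lemma isomorphic_trans (x y z : C) : isomorphic x y -> isomorphic y z -> isomorphic x z.
Proof.
move=> [f [f' [f'f ff']]] [g [g' [g'g gg']]]; exists (g \c f), (f' \c g').
split.
  by rewrite compmA -(compmA f') g'g compm1.
by rewrite compmA -(compmA g) ff' compm1.
Qed.

Lemma essentially_in (x : C) : S x -> essentially S x.
Proof. by exists x => //; exact: isomorphic_refl. Qed.

Lemma essentially_iso (x y : C) : isomorphic x y -> essentially S y -> essentially S x.
Proof. by move=> xy [z Sz yz]; exists z => //; exact: isomorphic_trans xy yz. Qed.

Lemma inclusion_full : full (inclusion S).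
Proof. by move=> x y h; exists h. Qed.

Lemma inclusion_faithful : faithful (inclusion S).
Proof. by []. Qed.

End Essentially.

(** * The open mapping theorem for Polish groups *)

Section NestedBalls.
Variables (R : realType) (T : topologicalType) (d : T -> T -> R).
Hypotheses (dm : is_metric d) (dt : induces_topology d) (dc : complete_metric d).
Local Open Scope ring_scope.
Implicit Types p q : T * R.

Definition mball p : set T := [set y | d p.1 y < p.2].

(** The strict inequality keeps even the closed ball of [q] inside the open ball of [p]; the last
    condition forces the radii to 0 along a sequence. *)
Definition refines p q := [/\ 0 < q.2, d p.1 q.1 + q.2 < p.2 & q.2 <= p.2 / 2].

Lemma mball_nbhs p : 0 < p.2 -> nbhs p.1 (mball p).
Proof. exact: metric_nbhs. Qed.

Lemma refine_at p x (U : set T) : mball p x -> nbhs x U ->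
  exists q, [/\ refines p q, q.1 = x & mball q `<=` U].
Proof.
move=> px /dt [e e0 eU].
have px0 : 0 < p.2 - d p.1 x by rewrite subr_gt0.
have p0 : 0 < p.2 by apply: le_lt_trans px; exact: metric_ge0.
(* The three bounds on the radius serve the inclusion in [U], the strict inequality and the halving,
   in this order. *)
exists (x, Num.min e (Num.min ((p.2 - d p.1 x) / 2) (p.2 / 2))); split=> //.
  rewrite /refines /= !lt_min e0 !divr_gt0 //; split=> //.
    rewrite -ltrBrDl !gt_min; apply/orP; right; apply/orP; left.
    by rewrite ltr_pdivrMr // ltr_pMr // ltr1n.
  by rewrite !ge_min lexx !orbT.
by move=> y; rewrite /mball /= !lt_min => /andP[ye _]; exact: eU.
Qed.

(** The centres form a Cauchy sequence. Their limit is within the closed ball of index [n.+1], hence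
    in the open ball of index [n]. *)
Lemma nested_balls (p : nat -> T * R) : (forall n, refines (p n) (p n.+1)) ->
  exists l : T, (forall n, mball (p n) l) /\
    forall A, nbhs l A -> exists N, forall n, (N <= n)%N -> mball (p n) `<=` A.
Proof.
move=> pR; have [_ ds dtr] := dm.
have r0 n : 0 < (p n.+1).2 by have [] := pR n.
have chain m n : d (p n).1 (p (n + m)%N).1 + (p (n + m)%N).2 <= (p n).2.
  elim: m => [|m IH]; first by rewrite addn0 (metric_refl dm) add0r.
  apply: le_trans IH; have [_ /ltW h _] := pR (n + m)%N.
  rewrite addnS; apply: le_trans (_ : _ <= d (p n).1 (p (n + m)%N).1 +
    (d (p (n + m)%N).1 (p (n + m).+1).1 + (p (n + m).+1).2)) _.
    by rewrite addrA lerD.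
  by rewrite lerD2l.
have near m n : (n <= m)%N -> d (p n).1 (p m).1 <= (p n).2.
  move=> nm; have := chain (m - n)%N n; rewrite subnKC //; apply: le_trans.
  rewrite lerDl; case: m {nm} => [|m]; last exact: ltW.
  by have [h1 h2 _] := pR 0%N; apply: ltW; apply: le_lt_trans h2;
    rewrite addr_ge0 ?(metric_ge0 dm) // ltW.
(* Halving is weakened to a bound of order 1/(n+1), from which the archimedean property gives
   [small]. *)
have decay n : (p n).2 * n.+1%:R <= (p 0%N).2.
  elim: n => [|n IH]; first by rewrite mulr1.
  apply: le_trans IH; have [h _ h2] := pR n.
  have pn0 : 0 <= (p n).2.
    by move: h2; rewrite ler_pdivlMr // => h2; apply: le_trans h2; rewrite mulr_ge0 // ltW.
  apply: le_trans (ler_wpM2r _ h2) _ => //.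
  rewrite -mulrA ler_wpM2l // mulrC ler_pdivrMr // -natrM ler_nat.
  by rewrite muln2 -addnn addSn addnS !ltnS leq_addl.
have small e : 0 < e -> exists N, forall n, (N <= n)%N -> (p n).2 < e.
  move=> e0; exists (Num.bound `|(p 0%N).2 / e|) => n Nn.
  have h : (p 0%N).2 < e * n.+1%:R.
    rewrite mulrC -ltr_pdivrMr //; apply: le_lt_trans (ler_norm _) _.
    apply: lt_le_trans (archi_boundP (normr_ge0 _)) _.
    by rewrite ler_nat (leq_trans Nn).
  by have := le_lt_trans (decay n) h; rewrite ltr_pM2r.
have [l ul] : exists l : T, (p n).1 @[n --> \oo] --> l.
  apply: dc => e e0; have [|N NP] := small (e / 2); first by rewrite divr_gt0.
  exists N => m n Nm Nn; rewrite [ltRHS]splitr.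
  apply: le_lt_trans (dtr _ (p N).1 _) _; rewrite (ds _ (p N).1).
  by apply: ltrD; apply: le_lt_trans (NP N _) => //; exact: near.
have lP n : mball (p n) l.
  rewrite /mball /=; have [_ h _] := pR n.
  apply: le_lt_trans h; apply: le_trans (dtr _ (p n.+1).1 _) _; rewrite lerD2l.
  apply/ler_addgt0Pr => e e0.
  have [N NP] := (metric_cvgP dt _ _).1 ul e e0.
  apply: le_trans (dtr _ (p (maxn N n.+1)).1 _) _; rewrite lerD //.
    by apply: near; exact: leq_maxr.
  by rewrite ds ltW // NP // leq_maxl.
exists l; split=> // A /dt [e e0 eA].
have [|N NP] := small (e / 2); first by rewrite divr_gt0.
exists N => n Nn y yn; apply: eA => /=; rewrite [ltRHS]splitr.
apply: le_lt_trans (dtr _ (p n).1 _) _; rewrite ds; apply: ltrD.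
  exact: lt_trans (lP n) (NP _ Nn).
exact: lt_trans yn (NP _ Nn).
Qed.

End NestedBalls.

(** If no closure had an interior point, every ball could be refined to one disjoint from [A n]. The
    limit of such a nested sequence would lie in no [A n]. *)
Lemma baire (R : realType) (T : topologicalType) (A : nat -> set T) (x0 : T) :
  polish_space R T -> (forall x, exists n, A n x) ->
  exists n (x : T), nbhs x (closure (A n)).
Proof.
move=> [_ [d [dm dt dc]]] Acover; apply: contrapT => noint.
(* Positivity of the radius sits inside the existential so that [choice] yields a total function;
   elsewhere [p] is a dummy value. *)
have step (np : nat * (T * R)) : exists q : T * R,
    (0 < np.2.2)%R -> refines d np.2 q /\ mball d q `&` A np.1 = set0.
  case: np => n p /=; case: (ltP 0%R p.2) => p0; last by exists p.
  have [y [py yA]] : exists y, mball d p y /\ ~ closure (A n) y.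
    apply: contrapT => H; apply: noint; exists n, p.1.
    apply: filterS (mball_nbhs dt p0) => y py.
    by apply: contrapT => yA; apply: H; exists y.
  have yA' : nbhs y (~` closure (A n)).
    by apply: open_nbhs_nbhs; split=> //; apply: closed_openC; exact: closed_closure.
  have [q [pq _ qA]] := refine_at dm dt py yA'.
  exists q => _; split=> //; rewrite -subset0 => z [/qA zA Az].
  by apply: zA; exact: subset_closure.
have [F FP] := choice step.
pose p := fix p n := if n is m.+1 then F (m, p m) else (x0, 1%R).
have p0 n : (0 < (p n).2)%R.
  by elim: n => [|n /(FP (n, p n)) [[]]].
have [l [lP _]] := nested_balls dm dt dc (fun n => (FP (n, p n) (p0 n)).1).
have [n Anl] := Acover l.
have := (FP (n, p n) (p0 n)).2; rewrite -subset0 => /(_ l); apply.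
by split=> //; exact: (lP n.+1).
Qed.

(** * Open surjections and continuous lifts *)

Section OpenMapping.
Variable R : realType.
Implicit Types G H : polishGroupType R.

Lemma mulg_nbhs G (x y : G) (A : set G) : nbhs (x * y)%g A ->
  exists2 B, nbhs x B & exists2 C, nbhs y C & forall b c, B b -> C c -> A (b * c)%g.
Proof.
move=> /(@mulg_continuous R G (x, y)) [[B C] /= [nB nC] BCA].
by exists B => //; exists C => // b c Bb Cc; exact: (BCA (b, c)).
Qed.

Lemma mulgl_continuous G (x : G) : continuous (fun y : G => (x * y)%g).
Proof.
move=> y A /mulg_nbhs [B nB [C nC BCA]]; apply: (filterS _ nC) => c Cc.
by apply: BCA => //; exact: nbhs_singleton.
Qed.

Lemma mulgr_continuous G (x : G) : continuous (fun y : G => (y * x)%g).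
Proof.
move=> y A /mulg_nbhs [B nB [C nC BCA]]; apply: (filterS _ nB) => b Bb.
by apply: BCA => //; exact: nbhs_singleton.
Qed.

Lemma divg_nbhs G (x y : G) (A : set G) : nbhs (x^-1 * y)%g A ->
  exists2 B, nbhs x B & exists2 C, nbhs y C & forall b c, B b -> C c -> A (b^-1 * c)%g.
Proof.
move=> /mulg_nbhs [B nB [C nC BCA]].
exists ((fun z : G => (z^-1)%g) @^-1` B); first exact: (@invg_continuous R G x).
by exists C => // b c; exact: BCA.
Qed.

Lemma divg1_nbhs G (A : set G) : nbhs (1%g : G) A ->
  exists2 B, nbhs (1%g : G) B & forall b c, B b -> B c -> A (b^-1 * c)%g.
Proof.
rewrite -{1}(mulVg (1%g : G)) => /divg_nbhs [B nB [C nC BCA]].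
by exists (B `&` C); [exact: filterI|move=> b c [Bb _] [_ Cc]; exact: BCA].
Qed.

(** Countably many sets f(gV), with g in a dense set, cover [H]. By Baire one of them is somewhere
    dense, and quotients of its elements lie in the image of V^-1 V, hence of [U]. *)
Lemma almost_open1 G H (f : polish_hom G H) (U : set G) :
  range f = [set: H] -> nbhs (1%g : G) U -> nbhs (1%g : H) (closure (f @` U)).
Proof.
move=> fT /divg1_nbhs [V nV VU].
have [[D /countable_injP [j jinj] dD] _] := @polish_space_subproof R G.
(* The injection [j] of [D] into the naturals indexes the translates; [A n] is empty when no element
   of [D] has index [n]. *)
pose A n := [set y | exists g v, [/\ D g, j g = n, V v & y = f (g * v)%g]].
have [x|n [z nz]] := @baire R H A 1%g (@polish_space_subproof R H).
  have [g _ <-] : range f x by rewrite fT.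
  have nO : nbhs g (fun h : G => V (h^-1 * g)%g).
    have : nbhs (g^-1 * g)%g V by rewrite mulVg.
    move=> /divg_nbhs [B nB [C nC BCV]]; apply: (filterS _ nB) => b Bb.
    by apply: BCV => //; exact: nbhs_singleton.
  have [h [Oh Dh]] := dD _ (ex_intro (fun h : G => (fun h0 : G => V (h0^-1 * g)%g)° h) g nO) (open_interior _).
  exists (j h), h, (h^-1 * g)%g; split=> //; last by rewrite mulVKg.
  exact: (interior_subset Oh).
have [_ [[g [_ [Dg gn _ _]]] _]] := nbhs_singleton nz _ nz.
have nz1 : nbhs (1%g : H) (fun h => closure (A n) (z * h)%g).
  by apply: mulgl_continuous; rewrite mulg1.
apply: (filterS _ nz1) => h zh W.
(* Write h as z^-1 (zh): both [z] and zh are limits of points of [A n], and by injectivity of [j]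
   these points involve the same g, which cancels. *)
rewrite -{1}(mulKg z h) => /divg_nbhs [B nB [C nC BCW]].
have [b [[g1 [v1 [Dg1 g1n Vv1 ->]]] Bb]] := nbhs_singleton nz B nB.
have [c [[g2 [v2 [Dg2 g2n Vv2 ->]]] Cc]] := zh C nC.
have g12 : g1 = g2 by apply: jinj; rewrite ?inE // g1n g2n.
subst g2; exists (f (v1^-1 * v2)%g); split; first by exists (v1^-1 * v2)%g => //; exact: VU.
have := BCW _ _ Bb Cc; rewrite -polish_funV -polish_funM.
by rewrite invgM !mulgA mulgVK.
Qed.

Lemma almost_open G H (f : polish_hom G H) (x : G) (U : set G) :
  range f = [set: H] -> nbhs x U -> nbhs (f x) (closure (f @` U)).
Proof.
move=> fT; rewrite -{1}(mulg1 x) => /(@mulgl_continuous _ x) nU.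
have nfx : nbhs (f x) (fun y : H => closure (f @` [set u | U (x * u)%g]) ((f x)^-1 * y)%g).
  by apply: mulgl_continuous; rewrite mulVg; exact: almost_open1.
apply: (filterS _ nfx) => y yP W.
rewrite -{1}(mulVKg (f x) y) => /(@mulgl_continuous _ (f x)) /yP [_ [[u Uu <-] Wu]].
by exists (f (x * u)%g); split; [exists (x * u)%g|rewrite polish_funM].
Qed.

(* For y near 1 the homomorphism f is almost open, so one can shrink balls around
   two points x1, x2 of V, keeping an open set in the closures of both the image
   of the first ball and the translate by y of the image of the second one. In
   the limit f x1 = f x2 * y, hence y = f (x2^-1 * x1). Completeness of a merely
   compatible metric suffices, as no partial products have to converge. *)
Lemma open_mapping1 G H (f : polish_hom G H) (U : set G) :
  range f = [set: H] -> nbhs (1%g : G) U -> nbhs (1%g : H) (f @` U).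
Proof.
move=> fT /divg1_nbhs [V nV VU].
have [_ [d [dm dt dc]]] := @polish_space_subproof R G.
have [_ [dH [dHm dHt _]]] := @polish_space_subproof R H.
have [e e0 eV] := (dt _ _).1 nV.
pose O := (closure (f @` [set x | d 1%g x < e]%R))°.
have O1 : O 1%g by rewrite -(polish_fun1 f); apply: almost_open => //; exact: metric_nbhs.
have nO : nbhs (1%g : H) O by exact: open_nbhs_nbhs (conj (open_interior _) O1).
apply: (filterS _ nO) => y Oy.
pose good (s : (G * R) * (G * R) * set H) :=
  [/\ open s.2, s.2 !=set0, s.2 `<=` closure (f @` mball d s.1.1) &
    s.2 `<=` closure ((fun x => f x * y)%g @` mball d s.1.2)].
have step s : exists s', good s ->
    [/\ good s', refines d s.1.1 s'.1.1 & refines d s.1.2 s'.1.2].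
  case: s => [[p p'] W].
  have [|bad] := pselect (good (p, p', W)); last by exists (p, p', W).
  move=> [/= oW [w Ww] Wp Wp'].
  have [_ [[x px <-] Wx]] := Wp w Ww W (open_nbhs_nbhs (conj oW Ww)).
  have [q [pq qx _]] := refine_at dm dt px (@filterT _ (nbhs x) _).
  have [q0 _ _] := pq.
  pose W1 := W `&` (closure (f @` mball d q))°.
  have oW1 : open W1 by apply: openI => //; exact: open_interior.
  have W1x : W1 (f x).
    by split=> //; apply: almost_open => //; rewrite -qx; exact: mball_nbhs.
  (* The second ball is shrunk after the first, around a point whose translated image is already in
     [W1]; so [W2] is nonempty and inherits the first closure condition. *)
  have [_ [[x' px' <-] W1x']] := Wp' _ Wx W1 (open_nbhs_nbhs (conj oW1 W1x)).
  have [q' [pq' qx' _]] := refine_at dm dt px' (@filterT _ (nbhs x') _).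
  have [q'0 _ _] := pq'.
  pose W2 := W1 `&` (fun z => z * y^-1)%g @^-1` (closure (f @` mball d q'))°.
  exists (q, q', W2) => _; split=> //; split=> /=.
  - apply: openI => //; apply: open_comp; last exact: open_interior.
    by move=> z _; exact: mulgr_continuous.
  - exists (f x' * y)%g; split=> //=; rewrite mulgK.
    by apply: almost_open => //; rewrite -qx'; exact: mball_nbhs.
  - by move=> z [[_ /interior_subset]].
  - move=> z [_ /interior_subset zq'] A.
    rewrite -{1}(mulgVK y z) => /(@mulgr_continuous _ y) /zq' [_ [[v vq' <-] Av]].
    by exists (f v * y)%g; split=> //; exists v.
have [F FP] := choice step.
pose s := fix s n := if n is m.+1 then F (s m)
  else ((1%g : G, e), (1%g : G, e), O `&` (fun z => z * y^-1)%g @^-1` O).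
have sgood n : good (s n).
  elim: n => [|n /FP[]//]; split=> /=.
  - apply: openI; first exact: open_interior.
    by apply: open_comp; [move=> z _; exact: mulgr_continuous|exact: open_interior].
  - by exists y; split=> //=; rewrite mulgV.
  - by move=> z [/interior_subset].
  - move=> z [_ /interior_subset zO] A.
    rewrite -{1}(mulgVK y z) => /(@mulgr_continuous _ y) /zO [_ [[v vO <-] Av]].
    by exists (f v * y)%g; split=> //; exists v.
have r1 n : refines d (s n).1.1 (s n.+1).1.1 by have [] := FP _ (sgood n).
have r2 n : refines d (s n).1.2 (s n.+1).1.2 by have [] := FP _ (sgood n).
have [x1 [x1P x1l]] := nested_balls dm dt dc r1.
have [x2 [x2P x2l]] := nested_balls dm dt dc r2.
(* Late balls map into given neighbourhoods of the two points. The open set [s.2] lies in both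
   closures, so the two images can be compared inside the interior of [A]. *)
have fx : f x1 = (f x2 * y)%g.
  apply: (metric_hausdorff dHm dHt) => A B nA nB.
  have [N1 N1P] := x1l (f @^-1` A°) (@polish_fun_continuous _ _ _ f x1 _ (nbhs_interior nA)).
  have [N2 N2P] := x2l (fun x => B (f x * y)%g)
    (@polish_fun_continuous _ _ _ f x2 _ (@mulgr_continuous _ y _ _ nB)).
  have [oW [w Ww] h1 h2] := sgood (maxn N1 N2).
  have [_ [[v vb <-] Wv]] := h1 w Ww _ (open_nbhs_nbhs (conj oW Ww)).
  have Av : A° (f v) by apply: N1P vb; exact: leq_maxl.
  have [_ [[v' vb' <-] Av']] := h2 _ Wv _ (open_nbhs_nbhs (conj (open_interior A) Av)).
  exists (f v' * y)%g; split; first exact: interior_subset Av'.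
  by apply: N2P vb'; exact: leq_maxr.
exists (x2^-1 * x1)%g; last by rewrite polish_funM polish_funV fx mulKg.
by apply: VU; apply: eV; [exact: (x2P 0%N)|exact: (x1P 0%N)].
Qed.

Lemma bijective_polish_iso G H (f : polish_hom G H) :
  injective f -> range f = [set: H] ->
  exists g : polish_hom H G, cancel f g /\ cancel g f.
Proof.
move=> finj fT.
have /choice [g gK] : forall y : H, exists x, f x = y.
  by move=> y; have [x _ <-] : range f y by [rewrite fT]; exists x.
have fK : cancel f g by move=> x; apply: finj; rewrite gK.
have gM : {morph g : x y / (x * y)%g}.
  by move=> x y; apply: finj; rewrite polish_funM !gK.
suff gc : continuous g by exists (PolishHom gM gc).
move=> y A; rewrite -{1}(mulg1 (g y)) => /(@mulgl_continuous _ (g y)).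
move=> /(open_mapping1 fT) nA'.
have nA : nbhs y (fun z : H => (f @` [set x | A (g y * x)%g]) (y^-1 * z)%g).
  by apply: mulgl_continuous; rewrite mulVg.
apply: (filterS _ nA) => z [x xA fx].
have -> : z = (f (g y * x))%g by rewrite polish_funM gK fx mulVKg.
by rewrite /= fK.
Qed.

(** A graph argument: the pullback of [f] and [i] is Polish and projects bijectively onto [G]. The
    inverse of this projection is continuous, and composing it with the projection to [K] gives the
    lift. *)
Lemma polish_hom_lift G H K (i : polish_hom K H) (f : polish_hom G H) :
  injective i -> range f `<=` range i ->
  exists g : polish_hom G K, forall x, i (g x) = f x.
Proof.
move=> iinj fi.
pose P := equalizer (polish_comp f (polish_fst G K)) (polish_comp i (polish_snd G K)).
pose j : polish_hom P (G * K)%type := equalizer_incl _ _.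
have jP x : f (j x).1 = i (j x).2 := equalizer_inclP x.
have pinj : injective (polish_comp (polish_fst G K) j).
  move=> x y /= xy; apply: equalizer_incl_inj.
  rewrite -/j [LHS]surjective_pairing [RHS]surjective_pairing xy; congr (_, _).
  by apply: iinj; rewrite -!jP xy.
have pT : range (polish_comp (polish_fst G K) j) = [set: G].
  apply/seteqP; split=> // x _.
  have [k _ ik] : range i (f x) by apply: fi; exists x.
  have [z zE] := @equalizer_incl_ex _ _ _ (polish_comp f (polish_fst G K))
    (polish_comp i (polish_snd G K)) (x, k) (esym ik).
  by exists z => //; exact: (congr1 fst zE).
have [g [_ gK]] := bijective_polish_iso pinj pT.
exists (polish_comp (polish_snd G K) (polish_comp j g)) => x /=.
by rewrite -jP; congr (f _); exact: gK.
Qed.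

End OpenMapping.

(** * Regular epimorphisms of Polish groups *)

(* The discrete Polish group of integers, written multiplicatively. *)
Definition intgroup : Type := int.

HB.instance Definition _ := Choice.copy intgroup int.
HB.instance Definition _ := isGroup.Build intgroup
  (@addrA int) (@add0r int) (@addr0 int) (@addNr int) (@addrN int).
HB.instance Definition _ := Topological.copy intgroup (discrete_topology int).

Lemma nbhs_intgroup (n : intgroup) (A : set intgroup) : nbhs n A <-> A n.
Proof. exact: principal_filterP. Qed.

Lemma intgroup_continuous (T : topologicalType) (f : intgroup -> T) : continuous f.
Proof. by move=> n A nA; apply/nbhs_intgroup; exact: nbhs_singleton nA. Qed.

Lemma intgroup_mul_continuous : continuous (fun p : intgroup * intgroup => (p.1 * p.2)%g).
Proof.
move=> [m n] A /nbhs_intgroup Amn; exists ([set m], [set n]).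
  by split; exact/nbhs_intgroup.
by move=> [m' n'] [/= -> ->].
Qed.

Lemma intgroup_polish (R : realType) : polish_space R intgroup.
Proof.
split.
  exists [set: intgroup]; first exact: (@countableP int).
  by move=> O [n On] _; exists n.
have disc_lt1 (m n : intgroup) : (((m != n)%:R : R) < 1)%R -> m = n.
  by case: eqP => // _; rewrite ltxx.
exists (fun m n => (m != n)%:R%R); split.
- split=> [m n|m n|m n k].
  + by case: eqP => [->|mn] /=; split=> // /eqP; rewrite oner_eq0.
  + by rewrite eq_sym.
  + by rewrite -natrD ler_nat; case: eqP => // mk; case: eqP => // <-; case: eqP.
- move=> n A; rewrite nbhs_intgroup; split=> [An|[e e0 eA]].
    by exists 1%R => // m /disc_lt1 <-.
  by apply: eA => /=; rewrite eqxx.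
- move=> u /(_ 1%R ltr01) [N NP]; exists (u N) => A /nbhs_intgroup AN.
  by exists N => // n /= Nn; rewrite -(disc_lt1 _ _ (NP N n (leqnn N) Nn)).
Qed.

HB.instance Definition _ (R : realType) := isPolishGroup.Build R intgroup
  intgroup_mul_continuous (@intgroup_continuous _ _) (intgroup_polish R).

Section IntegerTest.
Variable R : realType.
Implicit Types G H : polishGroupType R.

Let Z : polishGroupType R := intgroup.

Lemma polish_hom_eq1 G H (f g : polish_hom G H) : f = g -> f =1 g.
Proof. by move=> ->. Qed.

Lemma intgroup_hom_ext G (f g : polish_hom Z G) : f (1%R : int) = g (1%R : int) -> f = g.
Proof.
move=> fg; apply: polish_hom_ext; elim/int_ind => [|n IH|n IH].
- exact: etrans (polish_fun1 f) (esym (polish_fun1 g)).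
- have -> : (Posz n.+1 : intgroup) = ((Posz n : intgroup) * ((1%R : int) : intgroup))%g.
    by rewrite /= -addn1 PoszD.
  by rewrite !polish_funM IH fg.
- have -> : ((- Posz n.+1)%R : intgroup) =
      (((- Posz n)%R : intgroup) * ((1%R : int) : intgroup)^-1)%g.
    by rewrite /= -addn1 PoszD opprD.
  by rewrite !polish_funM IH !polish_funV fg.
Qed.

Definition zpow G (x : G) (n : Z) : G :=
  match n with Posz m => (x ^+ m)%g | Negz m => (x ^- m.+1)%g end.

Lemma zpowS G (x : G) (n : int) : zpow x (n + 1)%R = (zpow x n * x)%g.
Proof.
case: n => [n|[|n]].
- by rewrite -PoszD addn1 /= expgSr.
- by rewrite /= expg1 mulVg.
- have -> : (Negz n.+1 + 1 = Negz n)%R by rewrite !NegzE -addn1 PoszD opprD addrNK.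
  by rewrite /= (expgS _ n.+1) invgM mulgVK.
Qed.

Lemma zpowM G (x : G) : {morph zpow x : m n / (m * n)%g}.
Proof.
move=> m; elim/int_ind => [|n IH|n IH].
- by rewrite mulg1 -[RHS]/(zpow x m * 1)%g mulg1.
- rewrite -addn1 PoszD -[(m * _)%g]/((m : int) + (Posz n + 1))%R addrA.
  by rewrite !zpowS mulgA -IH.
- apply: (@mulIg _ x); rewrite -mulgA -!zpowS -[(m * _)%g]/((m : int) + - Posz n.+1)%R.
  by rewrite -addn1 PoszD opprD addrA !addrNK.
Qed.

Definition zpow_hom G (x : G) : polish_hom Z G :=
  PolishHom (@zpowM G x) (@intgroup_continuous _ (zpow x)).

Lemma scaleM (c : int) : {morph (fun n : Z => (n : int) * c : Z)%R : m n / (m * n)%g}.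
Proof. by move=> m n; exact: mulrDl. Qed.

Definition scale (c : int) : polish_hom Z Z :=
  PolishHom (@scaleM c) (@intgroup_continuous _ _).

(* Pulling back along the homomorphism [n |-> z ^ n] reduces to a regular
   epimorphism q onto the integers; its image is k Z, and as the subgroup k Z
   is itself a Polish group, q / k factors through q, which forces k = 1. *)
Lemma regular_epi_surjective (HP : regular_category (Polish R))
    (X Y : polishGroupType R) (e : polish_hom X Y) :
  @regular_epi (Polish R) X Y e -> range e = [set: Y].
Proof.
move=> re; apply/seteqP; split=> // z _.
have [HL _ Hstab] := HP.
have [P [p [q pb]]] := @pullback_exists (Polish R) HL X Z Y e (zpow_hom z).
have rq := Hstab _ _ _ _ _ _ _ _ pb re; have [pbc _] := pb.
suff [x qx] : exists x : P, q x = (1%R : int).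
  exists (p x) => //; have := polish_hom_eq1 pbc x.
  by move=> /= ->; rewrite qx /= expg1.
(* If the image were trivial, the identity and the trivial endomorphism of the integers would agree
   after the epimorphism [q]. *)
have [k k0 [x0 qx0]] : exists2 k : nat, (0 < k)%N & exists x, q x = Posz k.
  apply: contrapT => noimg.
  have q0 x : q x = 0%R.
    case qx : (q x) => [[//|n]|n]; exfalso; apply: noimg; exists n.+1 => //.
      by exists x.
    by exists (x^-1)%g; rewrite polish_funV qx.
  have : polish_id Z = polish_trivial Z Z.
    by apply: (@regular_epi_epi (Polish R) P Z Z q _ _ rq); apply: polish_hom_ext => x /=; rewrite q0.
  by move=> /(congr1 (fun h : polish_hom Z Z => h (1%R : int))).
pose Q (m : nat) := (0 < m)%N && `[< exists x, q x = Posz m >].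
have Qex : exists m, Q m by exists k; rewrite /Q k0; apply/asboolP; exists x0.
case: (ex_minnP Qex) => {x0 k k0 qx0} k /andP[k0 /asboolP[x0 qx0]] kmin {Qex}.
have qpow (n : int) : q (zpow x0 n) = (n * Posz k)%R.
  suff /polish_hom_eq1 /(_ n) : polish_comp q (zpow_hom x0) = scale (Posz k) by [].
  by apply: intgroup_hom_ext; rewrite /= expg1 qx0 mul1r.
(* The remainder of [q x] modulo [k] is again a value of [q], so minimality of [k] makes it 0. *)
have kdiv x : (Posz k %| (q x : int))%Z.
  apply/dvdz_mod0P; set a : int := q x.
  pose b := (a %/ Posz k)%Z.
  have qb : q (x * zpow x0 (- b)%R)%g = (a %% Posz k)%Z.
    by rewrite polish_funM qpow mulNr.
  case am : (a %% Posz k)%Z => [[//|m]|m].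
    have Qm : Q m.+1 by apply/asboolP; exists (x * zpow x0 (- b)%R)%g; rewrite qb am.
    have := kmin _ Qm; have := @ltz_pmod a (Posz k) k0.
    by rewrite am ltz_nat ltnNge => /negbTE ->.
  by have := @modz_ge0 a (Posz k); rewrite am eqz_nat -lt0n => /(_ k0).
pose q' x : Z := ((q x : int) %/ Posz k)%Z.
have q'M : {morph q' : x y / (x * y)%g}.
  by move=> x y; rewrite /q' polish_funM -[(q x * q y)%g]/((q x : int) + q y)%R divzDl.
have q'c : continuous q'.
  apply: (@continuous_comp_fun _ _ _ q (fun n : Z => ((n : int) %/ Posz k)%Z : Z)).
    exact: polish_fun_continuous.
  exact: intgroup_continuous.
have [W [u [v [quv qu]]]] := rq.
have [|r [rq' _]] := qu Z (PolishHom q'M q'c).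
  apply: polish_hom_ext => w /=; rewrite /q'.
  by have /= -> := polish_hom_eq1 quv w.
have rk : r (Posz k) = (Posz k * r (1%R : int))%R.
  suff /polish_hom_eq1 /(_ (Posz k)) : r = scale (r (1%R : int)) by [].
  by apply: intgroup_hom_ext; rewrite /= mul1r.
have r1 : r (Posz k) = 1%R.
  rewrite -qx0; have /= -> := polish_hom_eq1 rq' x0.
  by rewrite /q' qx0 divzz eqz_nat -lt0n k0.
exists x0; rewrite qx0.
have : (Posz k %| (1%R : int))%Z by rewrite -r1 rk dvdz_mulr.
by rewrite dvdzE /= dvdn1 => /eqP ->.
Qed.

End IntegerTest.

(** * Relations between Polish groups and thick subcategories *)

Section RelatedCalculus.
Variables (R : realType) (HP : regular_category (Polish R)).
Implicit Types G H K : polishGroupType R.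

(* The integers represent the underlying set: the generalized elements
   Z -> G are the elements of G. *)
Lemma related_rmem G H (T : @relation (Polish R) G H) (g : G) (h : H) :
  related T g h <-> @rmem (Polish R) G H T _ (zpow_hom g) (zpow_hom h).
Proof.
split=> [[s Ts [t [<- <-]]]|/rmem_related /(_ (GRing.one int))].
  exists s => //; exists (zpow_hom t).
  by split; apply: intgroup_hom_ext => /=; rewrite !expg1.
by rewrite /= !expg1.
Qed.

Lemma related_converse G H (T : @relation (Polish R) G H) (g : G) (h : H) :
  related (converse T) h g <-> related T g h.
Proof. by rewrite !related_rmem rmem_converse. Qed.

Lemma related_le G H (T U : @relation (Polish R) G H) (g : G) (h : H) :
  rle T U -> related T g h -> related U g h.
Proof. by move=> /rle_mem TU /related_rmem /TU /related_rmem. Qed.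

(** Internal composition is composition of relations on elements. The cover in [rmem_rcomp] is
    surjective, so the middle element is read off at a point above the generator 1. *)
Lemma related_rcomp G H K (T : @relation (Polish R) G H)
    (U : @relation (Polish R) H K) (g : G) (k : K) :
  related (rcomp HP U T) g k <-> exists2 h, related T g h & related U h k.
Proof.
split=> [/related_rmem /rmem_rcomp [w [e [c [re Tc Uc]]]]|[h]].
  have [w0 _ ew0] : range (polish_fun e) (GRing.one int).
    by rewrite (regular_epi_surjective HP re).
  exists (polish_fun c w0).
    by have /= := rmem_related Tc w0; rewrite ew0 /= expg1.
  by have /= := rmem_related Uc w0; rewrite ew0 /= expg1.
move=> /related_rmem Tgh /related_rmem Uhk; apply/related_rmem.
exact: rmem_rcomp_in Tgh Uhk.
Qed.

Lemma related1 G H (T : @relation (Polish R) G H) : related T 1%g 1%g.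
Proof.
have [s Ts] := rspan_ex T; apply/(relatedE Ts); exists 1%g.
by rewrite !polish_fun1.
Qed.

Lemma ex_rel_refl (A : ex_obj (Polish R)) (g : ex_base A : polishGroupType R) :
  related (ex_rel A) g g.
Proof.
by apply/related_rmem; have [r _ _] := ex_relP A (intgroup : polishGroupType R); exact: r.
Qed.

Lemma ex_hom_total (A B : Ex HP) (T : hom A B) (g : ex_base A : polishGroupType R) :
  exists h, related (ex_graph T) g h.
Proof.
have := related_le (ex_total T) (ex_rel_refl g).
by move=> /related_rcomp [h Tgh _]; exists h.
Qed.

(** The pair (1, 1) lies in [T]. Composing with it turns functionality into one direction, and
    absorption of [ex_rel B] into the other. *)
Lemma ex_hom_kernel (A B : Ex HP) (T : hom A B) (h : ex_base B : polishGroupType R) :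
  related (ex_graph T) 1%g h <-> related (ex_rel B) 1%g h.
Proof.
split=> [Th|Rh].
  apply: (related_le (ex_functional T)); apply/related_rcomp; exists 1%g => //.
  by apply/related_converse; exact: related1.
by rewrite -(ex_homl T); apply/related_rcomp; exists 1%g => //; exact: related1.
Qed.

End RelatedCalculus.

(** * Kernels as Polish subgroups *)

Section Kernels.
Variable R : realType.
Implicit Types G H K X Y : polishGroupType R.

(** Uniqueness of the Polish topology on a Polish subgroup: each injection lifts along the other. *)
Lemma isomorphic_same_range K K' H (i : polish_hom K H) (j : polish_hom K' H) :
  injective i -> injective j -> range i = range j ->
  @isomorphic (Polish R) K K'.
Proof.
move=> iinj jinj ij.
have [|f fP] := @polish_hom_lift R _ _ _ j i jinj; first by rewrite ij.
have [|g gP] := @polish_hom_lift R _ _ _ i j iinj; first by rewrite ij.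
exists f, g; split; apply: polish_hom_ext => x /=.
  by apply: iinj; rewrite gP fP.
by apply: jinj; rewrite fP gP.
Qed.

Definition kernel X Y (q : polish_hom X Y) : polishGroupType R :=
  equalizer q (polish_trivial X Y).

Definition kernel_incl X Y (q : polish_hom X Y) : polish_hom (kernel q) X :=
  equalizer_incl q (polish_trivial X Y).

Lemma short_exact_kernel X Y (q : polish_hom X Y) :
  range q = [set: Y] -> short_exact (kernel_incl q) q.
Proof.
move=> qT; split=> //; split.
  by apply: polish_hom_ext => x; exact: (equalizer_inclP x).
move=> Z h qh; have [|l lP] := @polish_hom_lift R _ _ _ (kernel_incl q) h (@equalizer_incl_inj _ _ _ _ _).
  move=> _ [z _ <-]; have [x xz] := @equalizer_incl_ex _ _ _ q (polish_trivial X Y) (h z) (polish_hom_eq1 qh z).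
  by exists x.
exists l; split; first exact: polish_hom_ext.
move=> l' l'P; apply: polish_hom_ext => z; apply: equalizer_incl_inj.
by have /= := polish_hom_eq1 l'P z; rewrite -lP.
Qed.

Lemma leg2_kernel_inj G H (s : @span (Polish R) G H) : jointly_monic s ->
  injective (polish_comp (leg2 s : polish_hom _ _) (kernel_incl (leg1 s : polish_hom (apex s) G))).
Proof.
move=> js x y /= xy; apply: equalizer_incl_inj.
apply: (jointly_monic_injective js) xy.
exact: (etrans (equalizer_inclP x) (esym (equalizer_inclP y))).
Qed.

Lemma leg2_kernel_range G H (T : @relation (Polish R) G H) s : rspan T s ->
  range (polish_comp (leg2 s : polish_hom _ _) (kernel_incl (leg1 s : polish_hom (apex s) G))) =
  [set h | related T 1%g h].
Proof.
move=> Ts; apply/seteqP; split=> [_ [x _ <-]|h /(relatedE Ts) [t [t1 t2]]].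
  by apply/(relatedE Ts); exists (kernel_incl _ x); split=> //; exact: (equalizer_inclP x).
have [x xt] := @equalizer_incl_ex _ _ _ (leg1 s : polish_hom _ _) (polish_trivial _ _) t t1.
by exists x => //; rewrite -t2 -xt.
Qed.

End Kernels.

(** * Fullness and faithfulness for a thick subcategory *)

Section ThickFull.
Variables (R : realType) (HP : regular_category (Polish R)).
Variables (S : Polish R -> Prop) (HS : thick S).

Lemma thick_kernel (A : Polish R) (s : @span (Polish R) A A) :
  S (apex s) -> range (polish_fun (leg1 s)) = [set: A : polishGroupType R] ->
  essentially S (kernel (leg1 s : polish_hom _ _) : Polish R).
Proof.
move=> Ss qT.
(* Thickness is applied to [apex s] as a subobject of itself. *)
have mm : mono (idm (apex s)) by move=> w g h; rewrite !comp1m.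
have [_ /(_ _ _ _ Ss mm _ _ _ _ (short_exact_kernel qT)) [h _]] := HS.
by have [] := h (essentially_in Ss).
Qed.

Lemma Ex_inclusion_full : full (Ex_inclusion HP HS).
Proof.
move=> A B T.
have [s Ts] := rspan_ex (ex_graph T).
suff [z Sz sz] : essentially S (apex s).
  exact: (Ex_map_hom_onto (@inclusion_full _ S) (@inclusion_faithful _ S) (z := exist S z Sz) Ts sz).
(* The product is formed in the subcategory and preserved by the inclusion, so [apex s] is a
   subobject of an object satisfying [S]. *)
have [HL _ _] := thick_regular HS.
have [P [p [q Ppq]]] := product_exists HL (ex_base A) (ex_base B).
have Ppq' := preserves_product HS.1.2.1 Ppq.
have [m [[m1 m2] _]] := Ppq' _ (leg1 s) (leg2 s).
have mm : mono m by apply/(jointly_monicP Ppq' m1 m2); exact: rspan_jm Ts.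
have s1T : range (polish_fun (leg1 s)) = [set: _].
  apply/seteqP; split=> // g _; have [h /(relatedE Ts) [t [tg _]]] := ex_hom_total T g.
  by exists t.
have [_ /(_ _ _ _ (svalP P) mm _ _ _ _ (short_exact_kernel s1T)) [_]] := HS; apply.
split; last exact/essentially_in/svalP.
have [r Rr] := rspan_ex (ex_rel B).
have Rr' := relation_map_span (thick_regular HS) HS.1.2 Rr.
have r1T : range (polish_fun (leg1 (span_map (inclusion S) r))) = [set: _].
  apply/seteqP; split=> // g _.
  have /(relatedE Rr') [t [tg _]] := @ex_rel_refl R (Ex_inclusion HP HS B) g.
  by exists t.
apply: (@essentially_iso (Polish R) S _ (kernel (leg1 (span_map (inclusion S) r) : polish_hom _ _))).
  apply: (isomorphic_same_range (leg2_kernel_inj (rspan_jm Ts)) (leg2_kernel_inj (rspan_jm Rr'))).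
  rewrite (leg2_kernel_range Ts) (leg2_kernel_range Rr').
  by apply/seteqP; split=> h /= /(ex_hom_kernel T).
by apply: thick_kernel => //; exact: svalP.
Qed.

Lemma Ex_inclusion_faithful : faithful (Ex_inclusion HP HS).
Proof. exact: Ex_map_faithful (@inclusion_full _ S) (@inclusion_faithful _ S). Qed.

Lemma S_cover_Ex_inclusion (A : Ex (thick_regular HS)) :
  S_cover S (ex_cover (Ex_inclusion HP HS A)).
Proof.
split; first exact/essentially_in/svalP.
have [s Rs] := rspan_ex (ex_rel A).
have Rs' := relation_map_span (thick_regular HS) HS.1.2 Rs.
exists (sval (apex s)), (polish_pair (leg1 s) (leg2 s)); split.
- by move=> x y /= [] xy1 xy2; exact: (jointly_monic_injective (rspan_jm Rs')).
- apply/seteqP; split=> [_ [t _ <-]|[g h] /ex_coverP /(relatedE Rs') [t [t1 t2]]].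
    by apply/ex_coverP/(relatedE Rs'); exists t.
  by exists t => //; rewrite -t1 -t2.
- exact/essentially_in/svalP.
Qed.

End ThickFull.

(** * Continuous homomorphisms as morphisms of [PC] *)

Lemma continuous_borel_fun (T U : topologicalType) (f : T -> U) :
  continuous f -> borel_fun f.
Proof.
move=> fc B /(_ [set V | <<s @open T >> (f @^-1` V)]); apply.
split; last by move=> V oV; apply: sub_sigma_algebra; apply: open_comp.
have [s0 sD sU] := smallest_sigma_algebra [set: T] (@open T).
split=> [|V sV|V sV] /=; first by rewrite preimage_set0.
  by rewrite setTD -preimage_setC -setTD; exact: sD.
by rewrite preimage_bigcup; exact: sU.
Qed.

Lemma polish_hom_bdh (R : realType) (P Q : polish_cover R)
    (f : polish_hom (cover_group P) (cover_group Q)) :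
  (forall x, cover_kernel x -> cover_kernel (f x)) ->
  exists h : borel_definable_hom P Q, forall g, h (coset_of g) = coset_of (f g).
Proof.
move=> fN.
pose h (a : quo P) : quo Q := coset_of (f (repr a)).
have hE g : h (coset_of g) = coset_of (f g).
  apply/coset_ofP; rewrite -polish_funV -polish_funM; apply: fN.
  by apply/coset_ofP; exact: reprK.
have hM : {morph h : x y / (x * y)%g}.
  move=> a b; have [x <-] := coset_of_surj a; have [y <-] := coset_of_surj b.
  by rewrite -coset_ofM !hE polish_funM coset_ofM.
have hl : exists2 f' : cover_group P -> cover_group Q, borel_fun f' &
    forall g, h (coset_of g) = coset_of (f' g).
  by exists f => //; apply: continuous_borel_fun; exact: polish_fun_continuous.
by exists (BorelDefinableHom hM hl).
Qed.

Lemma polish_iso_PC (R : realType) (P Q : PC R)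
    (f : polish_hom (cover_group P) (cover_group Q))
    (g : polish_hom (cover_group Q) (cover_group P)) :
  cancel f g -> cancel g f ->
  (forall x, cover_kernel x <-> cover_kernel (f x)) -> isomorphic P Q.
Proof.
move=> fK gK fN.
have [|F FE] := @polish_hom_bdh _ _ _ f; first by move=> x /fN.
have [|G GE] := @polish_hom_bdh _ _ _ g; first by move=> x; rewrite fN gK.
exists F, G; split; apply: bdh_ext => a /=; have [x <-] := coset_of_surj a.
  by rewrite FE GE fK.
by rewrite GE FE gK.
Qed.

(** * The essential image *)

Section EssentiallySurjective.
Variables (R : realType) (HP : regular_category (Polish R)).
Variables (S : Polish R -> Prop) (HS : thick S).

Lemma S_cover_essential_image (Q : PC R) : S_cover S Q ->
  exists A : Ex (thick_regular HS),
    @isomorphic (PC R) (ex_cover (Ex_inclusion HP HS A)) Q.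
Proof.
move=> [[y Sy [f [f' [f'f ff']]]] [K [i [iinj irange [z Sz [k [k' [k'k kk']]]]]]]].
have fK : cancel (polish_fun f) (polish_fun f') := polish_hom_eq1 f'f.
have f'K : cancel (polish_fun f') (polish_fun f) := polish_hom_eq1 ff'.
have kK : cancel (polish_fun k) (polish_fun k') := polish_hom_eq1 k'k.
have k'K : cancel (polish_fun k') (polish_fun k) := polish_hom_eq1 kk'.
pose G : full_subcategory S := exist S y Sy.
(* The group [K] and its two projections are transported along [k'] and [f] to groups that satisfy
   [S] strictly. *)
pose l (p : polish_hom (cover_group Q * cover_group Q)%type (cover_group Q)) :
  hom (exist S z Sz : full_subcategory S) G := polish_comp f (polish_comp p (polish_comp i k')).
pose s : span G G := Span (l (polish_fst _ _)) (l (polish_snd _ _)).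
pose eqG (a b : y : polishGroupType R) := coset_of (f' a) = coset_of (f' b) :> quo Q.
have sP (a b : y : polishGroupType R) : eqG a b <-> exists t : z : polishGroupType R,
    l (polish_fst _ _) t = a /\ l (polish_snd _ _) t = b.
  split=> [ab|[t [<- <-]]].
    have [w _ wE] : range i (f' a, f' b) by rewrite irange.
    by exists (k w); rewrite /= kK wE /= !f'K.
  have : range i (i (k' t)) by exists (k' t).
  by rewrite irange /eqG /= !fK.
have linj t u : l (polish_fst _ _) t = l (polish_fst _ _) u ->
    l (polish_snd _ _) t = l (polish_snd _ _) u -> t = u.
  move=> /(can_inj fK) tu1 /(can_inj fK) tu2; apply: (can_inj k'K); apply: iinj.
  by rewrite [LHS]surjective_pairing [RHS]surjective_pairing; congr (_, _).
have js : jointly_monic s.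
  move=> w g h gh1 gh2; apply: polish_hom_ext => t; apply: linj.
    exact: (polish_hom_eq1 gh1 t).
  exact: (polish_hom_eq1 gh2 t).
have Rs : rspan (relation_of js) s by split=> //; exact: span_equiv_refl.
(* Membership of generalized elements is tested pointwise: [polish_hom_lift] supplies the continuous
   factorization. The equivalence axioms then follow from those of equality of cosets. *)
have memP v (a b : hom v G) : rmem (relation_of js) a b <->
    forall t, eqG (polish_fun a t) (polish_fun b t).
  rewrite (rmemE Rs); split=> [[c [<- <-]] t|ab]; first by apply/sP; exists (polish_fun c t).
  have pinj : injective (polish_pair (l (polish_fst _ _)) (l (polish_snd _ _))).
    by move=> t u /= [] /linj h /h.
  have [|c cP] := @polish_hom_lift R _ _ _ _ (polish_pair a b) pinj.
    by move=> _ [t _ <-]; have /sP [u [u1 u2]] := ab t; exists u => //=; rewrite -u1 -u2.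
  by exists c; split; apply: polish_hom_ext => t; have [] := cP t.
have eqR : is_equivalence_relation (relation_of js).
  move=> v; split=> [a|a b|a b c]; rewrite !memP //.
    by move=> ab t; rewrite /eqG ab.
  by move=> ab bc t; rewrite /eqG ab bc.
pose A : Ex (thick_regular HS) := ExObj eqR.
exists A.
apply: (@polish_iso_PC R (ex_cover (Ex_inclusion HP HS A)) Q f' f) => // x.
have Rs' := relation_map_span (thick_regular HS) HS.1.2 Rs.
have -> : cover_kernel (f' x) <-> eqG 1%g x.
  by rewrite /eqG coset_ofP polish_fun1 invg1 mul1g.
rewrite sP; exact: (relatedE Rs').
Qed.

End EssentiallySurjective.

Theorem theorem4p11 (R : realType)
    (HP : regular_category (Polish R))
    (E : canonical_functor HP) (HE : is_equivalence E)
    (S : Polish R -> Prop) (HS : thick S) :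
  exists HC : forall A : Ex (thick_regular HS),
      S_cover S (functor_comp E (Ex_inclusion HP HS) A),
    is_equivalence
      (corestriction (S_cover S) (functor_comp E (Ex_inclusion HP HS)) HC).
Proof.
exists (@S_cover_Ex_inclusion R HP S HS).
apply: equivalence_of_full_faithful.
- exact: (functor_comp_full (equivalence_full HE) (@Ex_inclusion_full _ _ _ HS)).
- move=> A B T U; apply: (functor_comp_faithful (equivalence_faithful HE) (@Ex_inclusion_faithful _ _ _ HS)).
(* On objects [E] is [ex_cover] by definition, and an isomorphism of [PC] is one in the full
   subcategory. *)
- move=> [Q SQ]; have [A [f [g [gf fg]]]] := S_cover_essential_image HP HS SQ.
  by exists A, f, g.
Qed.
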